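(* Let $n\geq 1$ and let $\mathcal{A}=(A_1,\dots,A_n)$ be a tuple of matrices with $A_i\in\mathbb{Z}_{\geq 0}^{n\times m_i}$. Let $L_1=\cdots=L_n$ be the $n\times(n+1)$-matrix with columns $0,e_1,\dots,e_n$ (in this order), and let $B_i$ be the $n\times(n+1)$-matrix with columns $0,\deg(A_i)e_1,\dots,\deg(A_i)e_n$ (in this order). Define sets $S_0,S_1,\dots,S_n$ of tuples of index pairs by the following procedure. Put $S_0:=\{((1,2),(2,3),\dots,(n,n+1))\}$. For $i=1,\dots,n$: - let $\mathcal{A}'_i:=(A_1,\dots,A_{i-1},[B_i\,A_i],L_{i+1},\dots,L_n)$, where $[B_i\,A_i]$ is the matrix with the columns of $B_i$ followed by the columns of $A_i$; - let $\tau$ be the lift of $\mathcal{A}'_i$ equal to $-1$ at the columns of $B_i$ and $0$ at all other columns, and let $S'_i$ be the set of mixed cells of $\mathcal{A}'_i$ with respect to $\prec_\tau$ (computed by tropical homotopy continuation starting from $S_{i-1}$, regarded as the set of mixed cells of $\mathcal{A}'_i$ with respect to $\prec$); - let $S''_i$ be the set of those $M\in S'_i$ whose $i$th pair contains no index of a column of $B_i$; - let $S_i$ be obtained from $S''_i$ by subtracting $(n+1,n+1)$ from the $i$th pair of each element. Then the procedure is correct: for every $i=1,\dots,n$, the set $S_{i-1}$ is the set of mixed cells of $(A_1,\dots,A_{i-1},L_i,\dots,L_n)$ with respect to $\prec$ and, consequently, it is also the set of mixed cells of $\mathcal{A}'_i$ with respect to $\prec$; and the output $S_n$ is the set of mixed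 cells of $\mathcal{A}$ for the generic lift $\prec$.
   Context: The degree $\deg(A_i)$ is the largest sum of the entries of a column of $A_i$. The vectors $e_1,\dots,e_n$ are the standard basis vectors of $\mathbb{R}^n$. For a tuple $\mathcal{C}=(C_1,\dots,C_n)$ with $C_i\in\mathbb{Z}^{n\times r_i}$, $r=\sum_i r_i$, a lift is a vector $\omega=(\omega_1,\dots,\omega_n)\in\mathbb{R}^{r}=\mathbb{R}^{r_1}\times\cdots\times\mathbb{R}^{r_n}$, with one coordinate per column (coordinates ordered by matrix, and inside a matrix by column). Put $$L(C_i,\omega_i):=\mathrm{conv}_j\big((C_i)_{1,j},\dots,(C_i)_{n,j},(\omega_i)_j\big)+\{0\}^n\times\mathbb{R}_{\leq 0}\subseteq\mathbb{R}^{n+1}.$$ Let $\mathrm{Cayley}(\mathcal{C})$ be the $2n\times r$ matrix whose column corresponding to column $j$ of $C_i$ is that column stacked on top of the $i$th standard basis vector of $\mathbb{R}^n$. A tuple $((a_1,b_1),\dots,(a_n,b_n))$, where $a_i<b_i$ are indices of columns of $C_i$ (columns being numbered within each matrix, starting from 1), is a mixed cell of $\mathcal{C}$ with respect to $\omega$ if (i) the square submatrix of $\mathrm{Cayley}(\mathcal{C})$ formed by the $2n$ columns corresponding to $a_1,b_1,\dots,a_n,b_n$ has full rank, and (ii) the parallelepiped obtained as the Minkowski sum over $i$ of the segments joining the lifted $a_i$th column and the lifted $b_i$th column of $C_i$ is a facet of $L(C_1,\omega_1)+\cdots+L(C_n,\omega_n)$. The lexicographic ordering $\prec$ on $\mathbb{R}^r$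 (for any $r$) is represented by $(\varepsilon^0,\varepsilon^1,\dots,\varepsilon^{r-1})$ with $\varepsilon>0$ infinitesimally small: ''mixed cells with respect to $\prec$'' are the mixed cells with respect to the lift $(\varepsilon^0,\dots,\varepsilon^{r-1})$ for all sufficiently small real $\varepsilon>0$. For $\tau\in\mathbb{R}^r$, the ordering $\prec_\tau$ is defined by $u\prec_\tau v$ iff $\tau\cdot u<\tau\cdot v$, or $\tau\cdot u=\tau\cdot v$ and $u\prec v$; ''mixed cells with respect to $\prec_\tau$'' are the mixed cells with respect to the lift $\tau+\delta(\varepsilon^0,\dots,\varepsilon^{r-1})$ for all sufficiently small $\varepsilon>0$ and then all sufficiently small $\delta>0$ (depending on $\varepsilon$). Tropical homotopy continuation is a procedure which, given a tuple, the set of its mixed cells with respect to a generic start lift, and a target lift $\tau$, returns the set of mixed cells with respect to $\tau$ perturbed infinitesimally in the direction of the start lift.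
   Formalization: The claim that S_{i-1} is the set of mixed cells of A'_i (and the homotopy continuation step using it) is stated only for deg(A_i) > 0; it fails for n=1, A_1=[0], where A'_1=[0 0 0] has no mixed cell but S_0 is nonempty. The degree of a matrix with no columns is taken to be 0. *)

(* Defs.v *)
From HB Require Import structures.
From mathcomp Require Import all_boot all_order all_algebra.
From mathcomp Require Import all_classical all_reals all_analysis.

Set Implicit Arguments.
Unset Strict Implicit.
Unset Printing Implicit Defensive.

Import Order.TTheory GRing.Theory Num.Theory.
Import numFieldNormedType.Exports.

Local Open Scope classical_set_scope.
Local Open Scope ring_scope.

(* The members of a tuple C = (C_1, ..., C_n) have n rows but independent      *)
(* numbers of columns, so the number of columns is packed with the matrix.     *)
Record intmx (n : nat) := IntMx { ncols : nat; mx_of : 'M[int]_(n, ncols) }.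

Definition mxtuple (n : nat) := 'I_n -> intmx n.

Definition total_cols (n : nat) (C : mxtuple n) : nat :=
  (\sum_i ncols (C i))%N.

(* The value at i is the pair (a_i, b_i) of column indices of C_i, numbered    *)
(* from 1; the position i itself is an ordinal, hence numbered from 0.         *)
Definition pair_tuple (n : nat) := {ffun 'I_n -> nat * nat}.

(* tagnat.Rank i j is the position of column j (counted from 0) of C_i        *)
(* among all columns, ordered by matrix and then by column (see RankEsum).     *)
Definition column_pos (n : nat) (C : mxtuple n) (i : 'I_n)
    (j : 'I_(ncols (C i))) : 'I_(total_cols C) :=
  tagnat.Rank i j.
Arguments column_pos {n} C i j.

Definition cayley (n : nat) (C : mxtuple n) : 'M[int]_(n + n, total_cols C) :=
  \mxrow_(i < n) col_mx (mx_of (C i)) (\matrix_(k, j) (k == i)%:R).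

Section Polyhedra.
Variables (R : realType) (d : nat).
Implicit Types (P F : set 'cV[R]_d) (p q c x y : 'cV[R]_d).

Definition conv_hull (k : nat) (v : 'I_k -> 'cV[R]_d) : set 'cV[R]_d :=
  [set x | exists t : 'I_k -> R,
     [/\ forall j, 0 <= t j, \sum_j t j = 1 & x = \sum_j t j *: v j]].

Definition segment p q : set 'cV[R]_d :=
  [set (1 - t) *: p + t *: q | t in [set t : R | 0 <= t <= 1]].

Definition minkowski_sum (n : nat) (P : 'I_n -> set 'cV[R]_d) :
    set 'cV[R]_d :=
  [set x | exists2 f : 'I_n -> 'cV[R]_d,
     forall i, P i (f i) & x = \sum_i f i].

Definition is_face F P : Prop :=
  F !=set0 /\
  exists c, F = [set x | P x /\
    forall y, P y -> \sum_k c k 0 * y k 0 <= \sum_k c k 0 * x k 0].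

Definition affinely_independent (k : nat) (x : 'I_k.+1 -> 'cV[R]_d) : bool :=
  row_free (\matrix_(i < k) (x (lift ord0 i) - x ord0)^T).

Definition has_dim P (k : nat) : Prop :=
  (exists x : 'I_k.+1 -> 'cV[R]_d,
     (forall i, P (x i)) /\ affinely_independent x) /\
  (forall x : 'I_k.+2 -> 'cV[R]_d,
     (forall i, P (x i)) -> ~~ affinely_independent x).

Definition is_facet F P : Prop :=
  is_face F P /\ exists k, has_dim F k /\ has_dim P k.+1.

End Polyhedra.

Section MixedCells.
Variables (R : realType) (n : nat).
Implicit Types (C : mxtuple n) (M : pair_tuple n).

Definition lifted_column C (omega : 'rV[R]_(total_cols C)) (i : 'I_n)
    (j : 'I_(ncols (C i))) : 'cV[R]_(n + 1) :=
  col_mx (map_mx intr (col j (mx_of (C i))))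
         (const_mx (omega 0 (column_pos C i j))).
Arguments lifted_column {C} omega i j.

Definition downward_ray : set 'cV[R]_(n + 1) :=
  [set col_mx 0 (const_mx t) | t in [set t : R | t <= 0]].

Definition lifted_polyhedron C (omega : 'rV[R]_(total_cols C)) (i : 'I_n) :
    set 'cV[R]_(n + 1) :=
  [set x + y | x in conv_hull (lifted_column omega i)
             & y in downward_ray].

Definition mixed_cell C (omega : 'rV[R]_(total_cols C)) M : Prop :=
  exists a b : forall i, 'I_(ncols (C i)),
  [/\ forall i, M i = ((a i).+1, (b i).+1),
      forall i, (a i < b i)%N,
      \rank (map_mx intr
        (row_mx (colsub (fun i => column_pos C i (a i)) (cayley C))
                (colsub (fun i => column_pos C i (b i)) (cayley C))) : 'M[R]_(n + n))
        = (n + n)%N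
    & is_facet
        (minkowski_sum
           (fun i => segment (lifted_column omega i (a i))
                             (lifted_column omega i (b i))))
        (minkowski_sum (lifted_polyhedron omega))].

Definition lex_lift C (e : R) : 'rV[R]_(total_cols C) := \row_s e ^+ s.

Definition lex_mixed_cells C : set (pair_tuple n) :=
  [set M | \forall e \near 0^'+, mixed_cell (lex_lift C e) M].

(* The threshold for the inner variable may depend on the outer one.           *)
Definition lex_mixed_cells_at C (tau : 'rV[R]_(total_cols C)) :
    set (pair_tuple n) :=
  [set M | \forall e \near 0^'+, \forall del \near 0^'+,
     mixed_cell (tau + del *: lex_lift C e) M].

(* The input/output specification of tropical homotopy continuation with       *)
(* symbolic start lift the lexicographic one; nothing is required of an        *)
(* implementation when its input is not the set of mixed cells for that lift.  *)
Definition tropical_homotopy_continuation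
    (thc : forall C, set (pair_tuple n) -> 'rV[R]_(total_cols C) ->
           set (pair_tuple n)) : Prop :=
  forall C (S : set (pair_tuple n)) (tau : 'rV[R]_(total_cols C)),
    S = lex_mixed_cells C -> thc C S tau = lex_mixed_cells_at tau.

End MixedCells.

Section Procedure.
Variable n : nat.

(* Meant for matrices with nonnegative entries, where the default value 0 of   *)
(* the maximum only matters when there is no column at all.                    *)
Definition mxdeg (k : nat) (A : 'M[int]_(n, k)) : int :=
  \big[Num.max/0]_(j < k) \sum_(i < n) A i j.

Definition simplex_mx : 'M[int]_(n, 1 + n) := row_mx 0 1%:M.

Definition scaled_simplex_mx (c : int) : 'M[int]_(n, 1 + n) := row_mx 0 c%:M.

Variables (m : 'I_n -> nat) (A : forall i, 'M[int]_(n, m i)).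

(* In the next two definitions matrices are counted from 0: the first i of     *)
(* them are the A_k.                                                           *)
Definition stage_tuple (i : nat) : mxtuple n := fun k =>
  if (k < i)%N then IntMx (A k) else IntMx simplex_mx.

Definition aug_tuple (i : 'I_n) : mxtuple n := fun k =>
  if (k < i)%N then IntMx (A k)
  else if k == i then
    IntMx (row_mx (scaled_simplex_mx (mxdeg (A k))) (A k))
  else IntMx simplex_mx.

(* tagnat.sig1 s and tagnat.sig2 s are the matrix and the column (counted from *)
(* 0) to which position s belongs; in the matrix at i, the columns of the      *)
(* scaled simplex are those numbered below n + 1.                              *)
Definition target_lift (R : realType) (i : 'I_n) :
    'rV[R]_(total_cols (aug_tuple i)) :=
  \row_s (if (tagnat.sig1 s == i) && (tagnat.sig2 s < n.+1)%N then -1 else 0).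

Definition start_tuple : pair_tuple n := [ffun k : 'I_n => (k.+1, k.+2)].

Definition avoids_simplex (i : 'I_n) (M : pair_tuple n) : Prop :=
  (n.+1 < (M i).1)%N /\ (n.+1 < (M i).2)%N.

Definition shift_pair (i : 'I_n) (M : pair_tuple n) : pair_tuple n :=
  [ffun k => if k == i then ((M k).1 - n.+1, (M k).2 - n.+1)%N else M k].

End Procedure.

(* Main.v *)
Require Import Defs.
From mathcomp Require Import all_boot all_order all_algebra.
From mathcomp Require Import all_classical all_reals all_analysis.
From mathcomp Require Import zify ring lra.
Import Order.TTheory GRing.Theory Num.Theory.
Local Open Scope classical_set_scope.
Local Open Scope ring_scope.

(** For a generic lift, a mixed cell is a choice of two columns a_k, b_k in
    each matrix for which some functional (u, 1) on the lifted columns is maximal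
    exactly at a_k and b_k in every C_k. Maximality alone is necessary
    ([mixed_cell_weak]) and strict maximality is sufficient
    ([strict_mixed_cell]). The rank condition says that the edges b_k - a_k form
    a basis, hence u and all the slacks (the distances of the other columns below
    the maximum) are linear in the lift, with coefficients that depend only on
    the columns ([slack_form]). For the lift by powers of a small e the sign of a
    slack is the sign of its first nonzero coefficient; it is never zero, as the
    coefficient at the column itself is -1. So the mixed cells for the
    lexicographic lift do not change when the lifts of the columns are multiplied
    by positive weights, or when the exponents are replaced by others in the same
    order ([lex_mixed_cellsP]).

    Three comparisons then give the theorem by induction on the stage.
    - For n copies of the standard simplex, the start tuple is a mixed cell by an
      explicit choice of u, and it is the only one: for the functionals u and u'
      of two cells, no edge has just one end in the set of vertices where u' - u
      is maximal, so this set is everything and u = u' ([start_cells]).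
    - Replacing the simplex in matrix i by its dilation by the degree of A_i is a
      change of weights, and the columns of A_i appended to it lie in the dilated
      simplex but are lifted lower than its vertices, so they are always strictly
      below the maximum ([aug_lex_cells]).
    - For the target lift, perturbed by del times the lexicographic lift, a cell
      avoiding the dilated simplex has levels of order del, while the vertices of
      the simplex have levels near -1 and impose no condition. What remains
      is the condition for the next stage ([target_cells_shift]). *)

Set Implicit Arguments.
Unset Strict Implicit.
Unset Printing Implicit Defensive.

(** * Cells as maximizing pairs of columns *)

(** Columns are read off by natural numbers, as they are in pair tuples; 0 is
    the default value beyond the last column. *)
Definition colv n (C : intmx n) (j : nat) : 'cV[int]_n :=
  if insub j is Some j' then col j' (mx_of C) else 0.

Lemma colv_ord n (C : intmx n) (j : 'I_(ncols C)) : colv C j = col j (mx_of C).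
Proof. by rewrite /colv valK. Qed.

Section Cells.
Variables (R : realType) (n : nat).
Implicit Types (C : mxtuple n) (M : pair_tuple n) (w : 'I_n -> nat -> R).
Implicit Types (u : 'rV[R]_n) (k : 'I_n) (j : nat).

Definition rcol (C : intmx n) j : 'cV[R]_n := map_mx intr (colv C j).

(** The functional (u, 1) at the lifted column j of C k; mixed cells are the
    faces where such a functional is maximal. *)
Definition level C w u k j : R := (u *m rcol (C k) j) 0 0 + w k j.

(** The two columns of a pair, counted from 0. *)
Definition lo M k := (M k).1.-1.
Definition hi M k := (M k).2.-1.

Definition wf_pairs C M : Prop :=
  forall k, [&& (0 < (M k).1)%N, ((M k).1 < (M k).2)%N
            & ((M k).2 <= ncols (C k))%N].

Definition edge C M k : 'cV[R]_n := rcol (C k) (hi M k) - rcol (C k) (lo M k).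

(** The rank condition on the Cayley matrix, see [cayley_rank]. *)
Definition nondeg C M : Prop :=
  forall u, (forall k, u *m edge C M k = 0) -> u = 0.

(** [weak_cell] is necessary and [strict_cell] is sufficient for a mixed cell;
    for small lexicographic lifts the two coincide by [lex_weak_strict]. *)
Definition weak_cell C w M : Prop :=
  exists u, forall k,
    level C w u k (hi M k) = level C w u k (lo M k) /\
    forall j, (j < ncols (C k))%N -> level C w u k j <= level C w u k (lo M k).

Definition strict_cell C w M : Prop :=
  exists u, forall k,
    level C w u k (hi M k) = level C w u k (lo M k) /\
    forall j, (j < ncols (C k))%N -> j != lo M k -> j != hi M k ->
      level C w u k j < level C w u k (lo M k).

Lemma wf_lo_lt_hi C M k : wf_pairs C M -> (lo M k < hi M k)%N.
Proof. by move=> /(_ k) /and3P[]; rewrite /lo /hi; lia. Qed.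

Lemma wf_hi_lt C M k : wf_pairs C M -> (hi M k < ncols (C k))%N.
Proof. by move=> /(_ k) /and3P[]; rewrite /hi; lia. Qed.

Lemma wf_lo_lt C M k : wf_pairs C M -> (lo M k < ncols (C k))%N.
Proof. by move=> /(_ k) /and3P[]; rewrite /lo; lia. Qed.

Definition edge_mx C M : 'M[R]_n := \matrix_(x, k) edge C M k x 0.

Lemma edge_mx_mulr C M (s : 'cV[R]_n) :
  edge_mx C M *m s = \sum_k s k 0 *: edge C M k.
Proof.
apply/matrixP => x y; rewrite ord1 mxE summxE.
by apply: eq_bigr => k _; rewrite !mxE mulrC.
Qed.

Lemma edge_mx_mull C M u k : u *m edge C M k = const_mx ((u *m edge_mx C M) 0 k).
Proof.
apply/matrixP => x y; rewrite !mxE !ord1.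
by apply: eq_bigr => z _; rewrite [in RHS]mxE.
Qed.

Lemma nondeg_unit C M : nondeg C M -> edge_mx C M \in unitmx.
Proof.
move=> nd; rewrite -row_free_unit; apply: inj_row_free => v v0.
by apply: nd => k; rewrite edge_mx_mull v0 mxE; apply/matrixP => x y; rewrite !mxE.
Qed.

Lemma edges_independent C M (v : 'I_n -> R) : nondeg C M ->
  \sum_k v k *: edge C M k = 0 -> forall k, v k = 0.
Proof.
move=> nd v0 k.
have : edge_mx C M *m (\col_k v k) = 0.
  by rewrite edge_mx_mulr -[RHS]v0; apply: eq_bigr => l _; rewrite mxE.
move=> /(congr1 (mulmx (invmx (edge_mx C M)))).
rewrite mulKmx ?mulmx0 ?nondeg_unit // => /matrixP /(_ k 0).
by rewrite !mxE.
Qed.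

Lemma cayley_top C k (j : 'I_(ncols (C k))) x :
  cayley C (lshift n x) (column_pos C k j) = colv (C k) j x 0.
Proof.
have := mxrowK (fun i => col_mx (mx_of (C i)) (\matrix_(k, j) (k == i)%:R)) k.
move=> /matrixP /(_ (lshift n x) j).
by rewrite /submxrow mxE -/(cayley C) -/(column_pos C k j) => ->;
   rewrite col_mxEu colv_ord mxE.
Qed.

Lemma cayley_bot C k (j : 'I_(ncols (C k))) x :
  cayley C (rshift n x) (column_pos C k j) = (x == k)%:R.
Proof.
have := mxrowK (fun i => col_mx (mx_of (C i)) (\matrix_(k, j) (k == i)%:R)) k.
move=> /matrixP /(_ (rshift n x) j).
by rewrite /submxrow mxE -/(cayley C) -/(column_pos C k j) => ->;
   rewrite col_mxEd mxE.
Qed.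

(** A row vector (v, g) kills the 2n chosen columns of the Cayley matrix iff
    g k = - v a_k = - v b_k for all k, so it is determined by a functional v
    which kills all differences b_k - a_k. *)
Lemma cayley_rank C M (a b : forall i, 'I_(ncols (C i))) :
    (forall i, M i = ((a i).+1, (b i).+1)) ->
  \rank (map_mx intr
     (row_mx (colsub (fun i => column_pos C i (a i)) (cayley C))
             (colsub (fun i => column_pos C i (b i)) (cayley C))) : 'M[R]_(n + n))
    = (n + n)%N <-> nondeg C M.
Proof.
move=> Mab; set N := map_mx _ _.
have loE k : lo M k = a k by rewrite /lo Mab.
have hiE k : hi M k = b k by rewrite /hi Mab.
have colN (v g : 'rV[R]_n) (c : forall i, 'I_(ncols (C i))) k :
  (row_mx v g *m map_mx intr (colsub (fun i => column_pos C i (c i)) (cayley C))) 0 k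
   = (v *m rcol (C k) (c k)) 0 0 + g 0 k.
  rewrite mxE big_split_ord /=; congr (_ + _).
    rewrite mxE; apply: eq_bigr => x _.
    by rewrite row_mxEl 2!mxE cayley_top mxE.
  under eq_bigr => x _ do rewrite row_mxEr 2!mxE cayley_bot.
  rewrite (bigD1 k) //= eqxx mulr1 big1 ?addr0 // => x /negPf ->.
  by rewrite mulr0.
have NE (v g : 'rV[R]_n) : row_mx v g *m N = 0 <->
   forall k, (v *m rcol (C k) (a k)) 0 0 + g 0 k = 0 /\
             (v *m rcol (C k) (b k)) 0 0 + g 0 k = 0.
  rewrite /N map_row_mx mul_mx_row; split.
    rewrite -[0]row_mx0 => /eq_row_mx[/matrixP ea /matrixP eb] k; split.
      by rewrite -colN ea mxE.
    by rewrite -colN eb mxE.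
  move=> h; rewrite -[RHS]row_mx0; congr row_mx; apply/matrixP => x k;
    rewrite ord1 [RHS]mxE colN; by case: (h k).
split=> [rk v ve|nd].
  have fr : row_free N by rewrite /row_free rk.
  pose g : 'rV[R]_n := \row_k - (v *m rcol (C k) (a k)) 0 0.
  have /NE : forall k, (v *m rcol (C k) (a k)) 0 0 + g 0 k = 0 /\
             (v *m rcol (C k) (b k)) 0 0 + g 0 k = 0.
    move=> k; rewrite [g _ _]mxE subrr; split=> //.
    have := ve k; rewrite /edge loE hiE mulmxBr => /matrixP /(_ 0 0).
    by rewrite !mxE.
  move=> vgN; have : row_mx v g = 0.
    by apply: (row_free_inj fr); rewrite vgN mul0mx.
  by rewrite -[0]row_mx0 => /eq_row_mx[].
apply/eqP/inj_row_free => y; rewrite -[y]hsubmxK => /NE h.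
have v0 : lsubmx y = 0.
  apply: nd => k; have [ea eb] := h k.
  rewrite /edge loE hiE mulmxBr; apply/matrixP => x z; rewrite !ord1.
  have: (lsubmx y *m rcol (C k) (b k)) 0 0 - (lsubmx y *m rcol (C k) (a k)) 0 0 = 0
     by lra.
  by rewrite !mxE.
rewrite v0; suff -> : rsubmx y = 0 by rewrite row_mx0.
apply/matrixP => x k; rewrite ord1; have [ea _] := h k.
by move: ea; rewrite v0 mul0mx !mxE add0r.
Qed.

End Cells.

(** * From facets to maximizing pairs *)

Section Geometry.
Variables (R : realType) (n : nat).
Implicit Types (C : mxtuple n) (M : pair_tuple n).
Implicit Types (c x y : 'cV[R]_(n + 1)).

Definition pairing c x : R := \sum_k c k 0 * x k 0.

Lemma pairingD c x y : pairing c (x + y) = pairing c x + pairing c y.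
Proof.
by rewrite -big_split; apply: eq_bigr => k _; rewrite mxE mulrDr.
Qed.

Lemma pairingZ c t x : pairing c (t *: x) = t * pairing c x.
Proof.
by rewrite /pairing big_distrr; apply: eq_bigr => k _; rewrite mxE mulrCA.
Qed.

Lemma pairingB c x y : pairing c (x - y) = pairing c x - pairing c y.
Proof. by rewrite pairingD -scaleN1r pairingZ mulN1r. Qed.

Lemma pairing_sum c (I : finType) (f : I -> 'cV[R]_(n + 1)) :
  pairing c (\sum_i f i) = \sum_i pairing c (f i).
Proof.
rewrite /pairing exchange_big /=; apply: eq_bigr => k _.
by rewrite summxE big_distrr.
Qed.

Lemma pairing_col_mx c (x : 'cV[R]_n) t :
  pairing c (col_mx x (const_mx t)) =
  ((usubmx c)^T *m x) 0 0 + dsubmx c 0 0 * t.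
Proof.
rewrite /pairing big_split_ord big_ord1 /= col_mxEd !mxE; congr (_ + _).
by apply: eq_bigr => k _; rewrite !mxE (unsplitK (inl _)).
Qed.

Definition lift_value C (omega : 'rV[R]_(total_cols C)) (k : 'I_n) (j : nat) : R :=
  if insub j is Some j' then omega 0 (column_pos C k j') else 0.

Lemma lift_value_ord C (omega : 'rV[R]_(total_cols C)) k (j : 'I_(ncols (C k))) :
  lift_value omega k j = omega 0 (column_pos C k j).
Proof. by rewrite /lift_value valK. Qed.

Lemma lifted_columnE C (omega : 'rV[R]_(total_cols C)) k (j : 'I_(ncols (C k))) :
  lifted_column omega j = col_mx (rcol R (C k) j) (const_mx (lift_value omega k j)).
Proof. by rewrite /lifted_column lift_value_ord /rcol colv_ord. Qed.

Definition upward : 'cV[R]_(n + 1) := col_mx 0 (const_mx 1).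

Lemma ray_in_polyhedron C (omega : 'rV[R]_(total_cols C)) k
    (j : 'I_(ncols (C k))) s : 0 <= s ->
  lifted_polyhedron omega k (lifted_column omega j - s *: upward).
Proof.
move=> s0; exists (lifted_column omega j).
  exists (fun i => (i == j)%:R); split; first by move=> i; rewrite ler0n.
    by rewrite (bigD1 j) //= eqxx big1 ?addr0 // => i /negPf ->.
  rewrite (bigD1 j) //= eqxx scale1r big1 ?addr0 // => i /negPf ->.
  by rewrite scale0r.
exists (- s *: upward); last by rewrite scaleNr.
exists (- s); first by rewrite /= oppr_le0.
rewrite scale_col_mx scaler0; congr col_mx.
by apply/matrixP => x y; rewrite !mxE mulr1.
Qed.

Lemma column_in_polyhedron C (omega : 'rV[R]_(total_cols C)) k
    (j : 'I_(ncols (C k))) : lifted_polyhedron omega k (lifted_column omega j).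
Proof.
by rewrite -[X in lifted_polyhedron _ _ X]subr0 -(scale0r upward);
   apply: ray_in_polyhedron.
Qed.

Lemma lifted_edge C (omega : 'rV[R]_(total_cols C)) M
    (a b : forall i, 'I_(ncols (C i))) k :
  (forall i, M i = ((a i).+1, (b i).+1)) ->
  usubmx (lifted_column omega (b k) - lifted_column omega (a k)) = edge R C M k.
Proof.
move=> Mab; rewrite !lifted_columnE opp_col_mx add_col_mx col_mxKu.
by rewrite /edge /lo /hi Mab.
Qed.

Lemma sum_update (V : zmodType) (f : 'I_n -> V) k v :
  \sum_i (f i + (if i == k then v else 0)) = \sum_i f i + v.
Proof.
by rewrite big_split /= -big_mkcond big_pred1_eq.
Qed.

(** The functional c that cuts out the facet is positive on the upward
    direction, since the facet contains no vertical line segment; scaled to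
    (u, 1) it is maximal over C k at both a_k and b_k, because in a sum of
    points one summand can be replaced at a time. *)
Lemma mixed_cell_weak C (omega : 'rV[R]_(total_cols C)) M (k0 : 'I_n) :
  mixed_cell omega M ->
  [/\ wf_pairs C M, nondeg R C M & weak_cell C (lift_value omega) M].
Proof.
case=> a [b [Mab ltab rk [[Fne [c Fc]] _]]].
have nd : nondeg R C M by apply/cayley_rank/rk.
have wf : wf_pairs C M by move=> k; rewrite Mab /= ltnS ltab ltn_ord.
split=> //.
set F := minkowski_sum _ in Fc; set P := minkowski_sum _ in Fc.
pose pt k (j : 'I_(ncols (C k))) := lifted_column omega j.
pose x0 := \sum_k pt k (a k).
have seg0 k : segment (pt k (a k)) (pt k (b k)) (pt k (a k)).
  by exists 0; rewrite /= ?lexx ?ler01 // subr0 scale1r scale0r addr0.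
have seg1 k : segment (pt k (a k)) (pt k (b k)) (pt k (b k)).
  by exists 1; rewrite /= ?lexx ?ler01 // subrr scale1r scale0r add0r.
have x0F : F x0 by exists (fun k => pt k (a k)).
have maxF x y : F x -> P y -> pairing c y <= pairing c x.
  by rewrite Fc => -[_ h] /h.
have le_a k j : pairing c (pt k j) <= pairing c (pt k (a k)).
  have /(maxF _ _ x0F) : P (x0 + (pt k j - pt k (a k))).
    exists (fun l => pt l (a l) + if l == k then pt k j - pt k (a k) else 0).
      move=> l; case: eqP => [->|_]; last first.
        by rewrite addr0; apply: column_in_polyhedron.
      by rewrite addrC subrK; apply: column_in_polyhedron.
    by rewrite sum_update.
  by rewrite pairingD gerDl pairingB subr_le0.
have eq_ab k : pairing c (pt k (b k)) = pairing c (pt k (a k)).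
  apply/eqP; rewrite eq_le le_a /=.
  have xF : F (x0 + (pt k (b k) - pt k (a k))).
    exists (fun l => pt l (a l) + if l == k then pt k (b k) - pt k (a k) else 0).
      move=> l; case: eqP => [->|_]; last by rewrite addr0.
      by rewrite addrC subrK.
    by rewrite sum_update.
  have : P x0 by exists (fun k => pt k (a k)) => // l; apply: column_in_polyhedron.
  move=> /(maxF _ _ xF).
  by rewrite pairingD lerDl pairingB subr_ge0.
(* Were the last coordinate h of c zero, the face would contain x0 - upward,
   while a nonzero combination of the edges is never vertical. *)
have downP : P (x0 - upward).
  exists (fun l => pt l (a l) + if l == k0 then - upward else 0).
    move=> l; case: eqP => [->|_]; last by rewrite addr0; apply: column_in_polyhedron.
    by rewrite -[upward]scale1r; apply: ray_in_polyhedron.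
  by rewrite sum_update.
have upE : pairing c upward = dsubmx c 0 0.
  by rewrite pairing_col_mx mulmx0 mxE add0r mulr1.
set h := dsubmx c 0 0 in upE.
have h_ge0 : 0 <= h.
  by have := maxF _ _ x0F downP; rewrite pairingB upE gerBl.
have h_neq0 : h != 0.
  apply/eqP => h0.
  have : F (x0 - upward).
    rewrite Fc; split=> // y Py; apply: le_trans (maxF _ _ x0F Py) _.
    by rewrite -[leRHS]/(pairing c _) pairingB upE h0 subr0.
  case=> f fseg xf.
  have /fin_all_exists [s sE] : forall k, exists s,
      f k = pt k (a k) + s *: (pt k (b k) - pt k (a k)).
    move=> k; have [s _ <-] := fseg k; exists s.
    by rewrite scalerBl scale1r scalerBr addrAC -addrA.
  have dn : - upward = \sum_k s k *: (pt k (b k) - pt k (a k)).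
    apply: (addrI x0); rewrite xf -big_split; apply: eq_bigr => k _.
    by rewrite sE.
  have s0 : forall k, s k = 0.
    apply: (edges_independent nd); transitivity (usubmx (- upward)); last first.
      by rewrite opp_col_mx col_mxKu oppr0.
    rewrite dn linear_sum; apply: eq_bigr => k _.
    by rewrite linearZ /= (lifted_edge _ _ Mab).
  have : - upward = 0 by rewrite dn big1 // => k _; rewrite s0 scale0r.
  move=> /matrixP /(_ (rshift n 0) 0); rewrite !mxE (unsplitK (inr _)) mxE.
  by lra.
have h_gt0 : 0 < h by rewrite lt_neqAle eq_sym h_neq0.
have levE k (j : 'I_(ncols (C k))) :
    level C (lift_value omega) (h^-1 *: (usubmx c)^T) k j = h^-1 * pairing c (pt k j).
  rewrite /pt lifted_columnE pairing_col_mx mulrDr mulKf //.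
  by rewrite /level -scalemxAl mxE.
exists (h^-1 *: (usubmx c)^T) => k.
have -> : lo M k = a k by rewrite /lo Mab.
have -> : hi M k = b k by rewrite /hi Mab.
rewrite !levE eq_ab; split=> // j lj.
by rewrite -[j]/(val (Ordinal lj)) !levE ler_pM2l ?invr_gt0 ?le_a.
Qed.

End Geometry.

(** * From maximizing pairs to facets *)

Section StrictCells.
Variables (R : realType) (n : nat).
Implicit Types (C : mxtuple n) (M : pair_tuple n).

Lemma segment_in_polyhedron C (omega : 'rV[R]_(total_cols C)) k
    (i j : 'I_(ncols (C k))) x :
  segment (lifted_column omega i) (lifted_column omega j) x ->
  lifted_polyhedron omega k x.
Proof.
case=> t /= /andP[t0 t1] <-.
set p := _ + _; exists p; last first.
  exists 0; rewrite ?addr0 //; exists 0; rewrite /= ?lexx //.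
  by apply/matrixP => r s; rewrite !mxE; case: splitP => q _; rewrite mxE.
have pick1 (V : lmodType R) (f : 'I_(ncols (C k)) -> V) (r : R) (l : 'I_(ncols (C k))) :
    \sum_q (r * (q == l)%:R) *: f q = r *: f l.
  rewrite (bigD1 l) //= eqxx mulr1 big1 ?addr0 // => q /negPf ->.
  by rewrite mulr0 scale0r.
exists (fun q => (1 - t) * (q == i)%:R + t * (q == j)%:R); split.
- by move=> q; rewrite addr_ge0 // mulr_ge0 ?ler0n ?subr_ge0.
- have := pick1 R^o (fun=> 1) (1 - t) i; have := pick1 R^o (fun=> 1) t j.
  rewrite /GRing.scale /= !mulr1.
  under eq_bigr do rewrite mulr1.
  move=> tj; under eq_bigr do rewrite mulr1.
  by move=> ti; rewrite big_split /= ti tj subrK.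
- by under eq_bigr do rewrite scalerDl; rewrite big_split /= !pick1.
Qed.

(** A point where (u, 1) is maximal is a sum of points maximal in each summand,
    so the face is the parallelepiped itself. Its n edges are independent and
    (u, 1) is constant on it, which gives dimension n; with a downward direction
    the whole polyhedron has dimension n + 1. *)
Lemma strict_mixed_cell C (omega : 'rV[R]_(total_cols C)) M (k0 : 'I_n) :
    wf_pairs C M -> nondeg R C M -> strict_cell C (lift_value omega) M ->
  mixed_cell omega M.
Proof.
move=> wf nd [u hu].
pose a k := Ordinal (wf_lo_lt k wf); pose b k := Ordinal (wf_hi_lt k wf).
have Mab k : M k = ((a k).+1, (b k).+1).
  by move/and3P: (wf k) => [] /=; rewrite /lo /hi; case: (M k) => [] [|?] [|?].
have ab k : a k != b k.
  by apply/eqP => /(congr1 val) /= e; have := wf_lo_lt_hi k wf; rewrite e ltnn.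
exists a, b; split=> //; first by move=> k; exact: wf_lo_lt_hi.
  exact/(cayley_rank R Mab).
set F := minkowski_sum _; set P := minkowski_sum _.
pose pt k (j : 'I_(ncols (C k))) := lifted_column omega j.
pose x0 := \sum_k pt k (a k).
pose d k := pt k (b k) - pt k (a k).
pose c : 'cV[R]_(n + 1) := col_mx u^T (const_mx 1).
pose lev k (j : 'I_(ncols (C k))) := pairing c (pt k j).
pose top k := lev k (a k).
have levE k j : lev k j = level C (lift_value omega) u k j.
  rewrite /lev /pt lifted_columnE pairing_col_mx /c col_mxKu col_mxKd trmxK.
  by congr (_ + _); rewrite mxE mul1r.
have lev_b k : lev k (b k) = top k.
  by rewrite /top !levE; case: (hu k).
have lev_lt k j : j != a k -> j != b k -> lev k j < top k.
  by move=> ja jb; rewrite /top !levE; case: (hu k) => _; apply.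
have lev_le k j : lev k j <= top k.
  have [->|ja] := eqVneq j (a k); first by rewrite lexx.
  have [->|jb] := eqVneq j (b k); first by rewrite lev_b lexx.
  exact/ltW/lev_lt.
have downE s : pairing c (col_mx 0 (const_mx s)) = s.
  by rewrite pairing_col_mx mulmx0 /c col_mxKd !mxE add0r mul1r.
have seg_top k x : segment (pt k (a k)) (pt k (b k)) x -> pairing c x = top k.
  case=> t _ <-; rewrite pairingD !pairingZ -!/(lev _ _) lev_b -/(top k).
  by ring.
have poly_top k x : lifted_polyhedron omega k x -> pairing c x <= top k /\
    (pairing c x = top k -> segment (pt k (a k)) (pt k (b k)) x).
  case=> _ [t [t0 t1 ->]] [_ [s /= s0 <-] <-].
  (* The deficit of a point is made up by the columns below the top and by the
     ray, so it vanishes only on the segment. *)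
  have gap : top k - pairing c (\sum_j t j *: lifted_column omega j
       + col_mx 0 (const_mx s)) = \sum_j t j * (top k - lev k j) - s.
    rewrite pairingD downE pairing_sum.
    have topE : top k = \sum_j t j * top k by rewrite -big_distrl /= t1 mul1r.
    rewrite opprD addrA {1}topE -sumrB; congr (_ - _); apply: eq_bigr => j _.
    by rewrite pairingZ -/(lev k j) mulrBr.
  have t_ge0 j : 0 <= t j * (top k - lev k j) by rewrite mulr_ge0 // subr_ge0.
  have sum_ge0 : 0 <= \sum_j t j * (top k - lev k j) by apply: sumr_ge0.
  split; first by rewrite -subr_ge0 gap; lra.
  move/eqP; rewrite eq_sym -subr_eq0 gap => /eqP e.
  have s_eq0 : s = 0 by lra.
  have : \sum_j t j * (top k - lev k j) = 0 by lra.
  move=> /eqP; rewrite psumr_eq0 // => /allP z.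
  have t_eq0 j : j != a k -> j != b k -> t j = 0.
    move=> ja jb; have := z j (mem_index_enum _).
    by rewrite /= mulf_eq0 subr_eq0 [top k == _]gt_eqF ?orbF ?lev_lt // => /eqP.
  have two (V : zmodType) (f : 'I_(ncols (C k)) -> V) :
    (forall j, j != a k -> j != b k -> f j = 0) -> \sum_j f j = f (a k) + f (b k).
    move=> f0; rewrite (bigD1 (a k)) //= (bigD1 (b k)) /=; last by rewrite eq_sym ab.
    by rewrite big1 ?addr0 // => j /andP[]; apply: f0.
  exists (t (b k)); first by rewrite /= t0 -t1 two // lerDr t0.
  rewrite s_eq0 (two _ (fun j => t j *: lifted_column omega j)); last first.
    by move=> j ja jb; rewrite t_eq0 ?scale0r.
  have -> : 1 - t (b k) = t (a k) by rewrite -t1 two // addrK.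
  rewrite -[LHS]addr0; congr (_ + _).
  by apply/matrixP => r q; rewrite !mxE; case: splitP => z' _; rewrite mxE.
have x0F : F x0.
  exists (fun k => pt k (a k)) => // k.
  by exists 0; rewrite /= ?lexx ?ler01 // subr0 scale1r scale0r addr0.
have xdF k : F (x0 + d k).
  exists (fun l => pt l (a l) + if l == k then d k else 0).
    move=> l; case: eqP => [->|_].
      by rewrite addrC subrK; exists 1; rewrite /= ?lexx ?ler01 // subrr scale1r scale0r add0r.
    by rewrite addr0; exists 0; rewrite /= ?lexx ?ler01 // subr0 scale1r scale0r addr0.
  by rewrite sum_update.
have FP x : F x -> P x.
  by case=> f fs ->; exists f => // k; apply: segment_in_polyhedron (fs k).
have Ftop x : F x -> pairing c x = \sum_k top k.
  by case=> f fs ->; rewrite pairing_sum; apply: eq_bigr => k _; apply: seg_top.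
have Ptop x : P x -> pairing c x <= \sum_k top k.
  case=> f fs ->; rewrite pairing_sum; apply: ler_sum => k _.
  by case: (poly_top k (f k) (fs k)).
have dE v : \sum_k v k *: d k = 0 -> forall k, v k = 0.
  move=> e; apply: (edges_independent nd).
  rewrite -[RHS](_ : usubmx (0 : 'cV[R]_(n + 1)) = 0); last first.
    by apply/matrixP => r q; rewrite !mxE.
  rewrite -e linear_sum; apply: eq_bigr => k _.
  by rewrite linearZ /= (lifted_edge _ _ Mab).
split.
  split; first by exists x0.
  exists c; apply/seteqP; split=> x.
    move=> Fx; split; first exact: FP.
    by move=> y Py; rewrite -/(pairing c y) -/(pairing c x) (Ftop x Fx) Ptop.
  case=> -[f fP xf] xmax; exists f => // k.
  apply: (poly_top k (f k) (fP k)).2.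
  have := xmax x0 (FP _ x0F); rewrite -!/(pairing c _) (Ftop x0 x0F) xf pairing_sum => le1.
  have le2 l : pairing c (f l) <= top l by case: (poly_top l (f l) (fP l)).
  have : \sum_l (top l - pairing c (f l)) = 0.
    apply/eqP; rewrite eq_le; apply/andP; split; first by rewrite sumrB subr_le0.
    by apply: sumr_ge0 => l _; rewrite subr_ge0.
  move=> /eqP; rewrite psumr_eq0 => [/allP /(_ k (mem_index_enum _))|l _]; last first.
    by rewrite subr_ge0.
  by rewrite /= subr_eq0 => /eqP.
exists n; split; split.
- exists (fun i => x0 + oapp d 0 (unlift ord0 i)); split.
    by move=> i; case: unliftP => [l _|_] /=; [apply: xdF | rewrite addr0].
  apply: inj_row_free => v v0; apply/matrixP => r k; rewrite ord1 [RHS]mxE.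
  apply: (dE (v 0)); apply/matrixP => i q; rewrite ord1 summxE.
  move/matrixP: v0 => /(_ 0 i); rewrite mxE [RHS]mxE => v0; rewrite [RHS]mxE -[RHS]v0.
  apply: eq_bigr => l _; rewrite [X in _ = _ * X]mxE /= liftK unlift_none /= addr0.
  by rewrite [x0 + _]addrC addrK !mxE.
- move=> x Fx; apply/negP => /eqP rk.
  (* The face lies in a hyperplane orthogonal to c. *)
  set A := \matrix_(i < n.+1) _ in rk.
  have Ac : A *m c = 0.
    apply/matrixP => i q; rewrite ord1 [LHS]mxE [RHS]mxE.
    transitivity (pairing c (x (lift ord0 i) - x ord0)).
      by apply: eq_bigr => l _; rewrite !mxE mulrC.
    by rewrite pairingB !Ftop // subrr.
  have c0 : (0 < \rank c)%N.
    rewrite lt0n mxrank_eq0; apply/eqP => /matrixP /(_ (rshift n 0) 0).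
    by rewrite col_mxEd !mxE => /eqP; rewrite oner_eq0.
  by have := mulmx0_rank_max Ac; rewrite rk; lia.
- exists (fun i => x0 +
    if unlift ord0 i is Some i' then oapp d (- upward R n) (unlift ord0 i') else 0).
  split.
    move=> i; case: unliftP => [i' _|_] /=; last by rewrite addr0; apply: FP.
    case: unliftP => [l _|_] /=; first by apply: FP.
    exists (fun l => pt l (a l) + if l == k0 then - upward R n else 0).
      move=> l; case: eqP => [->|_]; last by rewrite addr0; apply: column_in_polyhedron.
      by rewrite -[upward R n]scale1r; apply: ray_in_polyhedron.
    by rewrite sum_update.
  apply: inj_row_free => v v0.
  have e : \sum_l v 0 (lift ord0 l) *: d l - v 0 ord0 *: upward R n = 0.
    apply/matrixP => i q; rewrite ord1.
    move/matrixP: v0 => /(_ 0 i); rewrite mxE [RHS]mxE => v0; rewrite [RHS]mxE -[RHS]v0.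
    rewrite [RHS]big_ord_recl mxE addrC; congr (_ + _).
      rewrite [X in _ = _ * X]mxE /= liftK unlift_none unlift_none /= addr0.
      by rewrite [x0 + _]addrC addrK !mxE mulrN.
    rewrite summxE; apply: eq_bigr => l _.
    rewrite [X in _ = _ * X]mxE /= liftK /= liftK unlift_none /= addr0.
    by rewrite [x0 + _]addrC addrK !mxE.
  (* The functional (u, 1) kills the edges but not the downward direction. *)
  have v00 : v 0 ord0 = 0.
    have : pairing c (\sum_l v 0 (lift ord0 l) *: d l - v 0 ord0 *: upward R n) = 0.
      by rewrite e; apply: big1 => q _; rewrite [X in _ * X]mxE mulr0.
    rewrite pairingB pairing_sum pairingZ downE mulr1 big1.
      by move=> h; lra.
    by move=> l _; rewrite pairingZ pairingB -!/(lev _ _) lev_b subrr mulr0.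
  rewrite v00 scale0r subr0 in e.
  apply/matrixP => r k; rewrite ord1 [RHS]mxE.
  by case: (unliftP ord0 k) => [l|] ->; [apply: (dE _ e) | ].
- move=> x _; apply/negP => /eqP rk.
  by have := rank_leq_col (\matrix_(i < n.+2) (x (lift ord0 i) - x ord0)^T); rewrite rk; lia.
Qed.

End StrictCells.

(** * Lexicographic lifts *)

Section NearZero.
Variable R : realType.
Implicit Types P Q : R -> Prop.

Lemma near0_mono P Q : (forall e, P e -> Q e) ->
  (\forall e \near (0 : R)^'+, P e) -> \forall e \near (0 : R)^'+, Q e.
Proof. by move=> PQ; apply: filterS. Qed.

Lemma near0_ex P : (\forall e \near (0 : R)^'+, P e) -> exists e, P e.
Proof. by move=> hP; apply: (@filter_ex _ _ (at_right_proper_filter (0 : R))). Qed.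

Lemma near0_and P Q : (\forall e \near (0 : R)^'+, P e) ->
  (\forall e \near (0 : R)^'+, Q e) -> \forall e \near (0 : R)^'+, P e /\ Q e.
Proof. exact: filterI. Qed.

Lemma near0_gt0 : \forall e \near (0 : R)^'+, 0 < e.
Proof. exact: nbhs_right_gt. Qed.

Lemma near0_lt (c : R) : 0 < c -> \forall e \near (0 : R)^'+, e < c.
Proof. exact: nbhs_right_lt. Qed.

End NearZero.

Section LowestTerm.
Variables (R : realType) (T : finType).
Implicit Types (z kap : T -> R) (p : T -> nat).

(** Once e is below |z s0| kap s0 / (K + 1), the term at s0 exceeds the sum of the
    others, which is at most e K times the lowest power of e. *)
Lemma lowest_term_sign z kap p s0 :
    z s0 != 0 -> (forall t, 0 < kap t) ->
    (forall t, t != s0 -> z t != 0 -> (p s0 < p t)%N) ->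
  \forall e \near 0^'+, 0 < z s0 * \sum_t z t * (kap t * e ^+ p t).
Proof.
move=> z0 kap0 pmin.
pose K := \sum_(t | t != s0) `|z t| * kap t.
have K0 : 0 <= K by apply: sumr_ge0 => t _; rewrite mulr_ge0 // ltW.
have z0' : 0 < `|z s0| by rewrite normr_gt0.
have q0 : 0 < `|z s0| * kap s0 / (K + 1).
  by rewrite divr_gt0 ?mulr_gt0 // ltr_wpDl.
near=> e.
have e0 : 0 < e by near: e; apply: nbhs_right_gt.
have e1 : e < 1 by near: e; apply: nbhs_right_lt.
have eK : e * (K + 1) < `|z s0| * kap s0.
  by rewrite -ltr_pdivlMr ?ltr_wpDl //; near: e; apply: nbhs_right_lt.
set r := \sum_(t | t != s0) z t * (kap t * e ^+ p t).
have r_le : `|r| <= e ^+ p s0 * (e * K).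
  apply: le_trans (ler_norm_sum _ _ _) _.
  rewrite mulrA big_distrr /=; apply: ler_sum => t ts0.
  have [->|zt] := eqVneq (z t) 0; first by rewrite mul0r normr0 mul0r mulr0.
  rewrite normrM (ger0_norm (_ : 0 <= kap t * _)); last first.
    by rewrite mulr_ge0 ?exprn_ge0 // ltW.
  rewrite mulrA mulrC ler_wpM2r ?mulr_ge0 // ?(ltW (kap0 _)) //.
  by rewrite -exprSr ler_wiXn2l ?pmin // ltW.
rewrite (bigD1 s0) //= -/r mulrDr.
have : `|z s0| * `|r| <= `|z s0| * (e ^+ p s0 * (e * K)) by rewrite ler_wpM2l.
have : - (`|z s0| * `|r|) <= z s0 * r by rewrite -normrM lerNl -normrN ler_norm.
have : z s0 * (z s0 * (kap s0 * e ^+ p s0)) =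
       `|z s0| * e ^+ p s0 * (`|z s0| * kap s0).
  rewrite -[in RHS]mulrACA -normrM mulrA -expr2 (ger0_norm (sqr_ge0 _)); ring.
have : 0 < `|z s0| * e ^+ p s0 by rewrite mulr_gt0 ?exprn_gt0.
set g := `|z s0| * e ^+ p s0 => g0 E1 E2.
have -> : `|z s0| * (e ^+ p s0 * (e * K)) = g * (e * K) by rewrite /g -!mulrA.
move=> E3; have : g * (e * K) < g * (`|z s0| * kap s0).
  rewrite ltr_pM2l //; apply: le_lt_trans eK.
  by rewrite mulrDr mulr1 lerDl ltW.
by lra.
Unshelve. all: by end_near.
Qed.

(** The sign is that of the lowest term, and rescaling or an order preserving
    change of exponents does not affect which term is the lowest. *)
Lemma lex_sign_invariant z kap kap' p p' t0 :
    z t0 != 0 -> (forall t, 0 < kap t) -> (forall t, 0 < kap' t) ->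
    (forall s t, z s != 0 -> z t != 0 -> s != t -> p s != p t) ->
    (forall s t, z s != 0 -> z t != 0 -> (p s < p t)%N = (p' s < p' t)%N) ->
    (\forall e \near 0^'+, 0 <= \sum_t z t * (kap t * e ^+ p t)) ->
  \forall e \near 0^'+, 0 < \sum_t z t * (kap' t * e ^+ p' t).
Proof.
move=> zt0 kap0 kap'0 pinj pmono near_ge0.
case: (@arg_minnP _ t0 (fun t => z t != 0) p zt0) => s0 zs0 s0min.
have pmin t : t != s0 -> z t != 0 -> (p s0 < p t)%N.
  by move=> ts zt; rewrite ltn_neqAle s0min // andbT pinj // eq_sym.
have pmin' t : t != s0 -> z t != 0 -> (p' s0 < p' t)%N.
  by move=> ts zt; rewrite -pmono // pmin.
have near1 := lowest_term_sign zs0 kap0 pmin.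
have near2 := lowest_term_sign zs0 kap'0 pmin'.
have z_gt0 : 0 < z s0.
  have [e [E1 E2]] := filter_ex (filterI near_ge0 near1).
  rewrite ltNge; apply/negP => z_le0.
  by have := mulr_le0_ge0 z_le0 E1; rewrite leNgt E2.
by apply: filterS near2 => e; rewrite pmulr_rgt0.
Qed.

End LowestTerm.

Section LexCells.
Variables (R : realType) (n : nat).
Implicit Types (C : mxtuple n) (M : pair_tuple n) (w : 'I_n -> nat -> R).
Implicit Types (u : 'rV[R]_n) (k l : 'I_n) (j : nat).
Implicit Types (p : 'I_n -> nat -> nat).

Definition on_edges C w M u : Prop :=
  forall k, level C w u k (hi M k) = level C w u k (lo M k).

Lemma sub_entry (x y : 'M[R]_1) : (x - y) 0 0 = x 0 0 - y 0 0.
Proof. by rewrite !mxE. Qed.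

Lemma edge_drop C w M u k : on_edges C w M u ->
  (u *m edge R C M k) 0 0 = w k (lo M k) - w k (hi M k).
Proof.
by move=> /(_ k); rewrite /level /edge mulmxBr sub_entry; lra.
Qed.

Lemma on_edges_exists C w M : nondeg R C M -> exists u, on_edges C w M u.
Proof.
move=> nd; pose r : 'rV[R]_n := \row_k (w k (lo M k) - w k (hi M k)).
exists (r *m invmx (edge_mx R C M)) => k.
have /(congr1 (fun x : 'M[R]_1 => x 0 0)) := edge_mx_mull C M (r *m invmx (edge_mx R C M)) k.
rewrite /= mulmxKV ?nondeg_unit // [const_mx _ 0 0]mxE [r 0 k]mxE.
by rewrite /level /edge mulmxBr sub_entry; lra.
Qed.

Definition max_cols C := \max_k ncols (C k).

(** The amount by which column j of C k lies below the top is linear in the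
    lift, because the difference of columns a_k and j is a combination of the
    edges, on which u is prescribed by the lift. Its coefficients depend on the columns only, and
    the one at (k, j) is -1 unless j is on the edge. *)
Lemma slack_form C M k j : wf_pairs C M -> nondeg R C M ->
    (j < ncols (C k))%N ->
  exists z : 'I_n * 'I_(max_cols C) -> R,
  [/\ forall w u, on_edges C w M u ->
        level C w u k (lo M k) - level C w u k j = \sum_t z t * w t.1 t.2,
      forall t, z t != 0 -> (t.2 < ncols (C t.1))%N
    & j != lo M k -> j != hi M k -> exists t, z t != 0].
Proof.
move=> wf nd jk; have colsB l i : (i < ncols (C l))%N -> (i < max_cols C)%N.
  by move=> il; apply: leq_trans il (leq_bigmax l).
pose x := invmx (edge_mx R C M) *m (rcol R (C k) (lo M k) - rcol R (C k) j).
pose z (t : 'I_n * 'I_(max_cols C)) : R :=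
  x t.1 0 * ((t.2 == lo M t.1 :> nat)%:R - (t.2 == hi M t.1 :> nat)%:R) +
  (t.1 == k)%:R * ((t.2 == lo M k :> nat)%:R - (t.2 == j :> nat)%:R).
have pick l i (f : nat -> R) : (i < ncols (C l))%N ->
    \sum_(q < max_cols C) (q == i :> nat)%:R * f q = f i.
  move=> il; rewrite (bigD1 (Ordinal (colsB _ _ il))) //= eqxx mul1r big1 ?addr0 //.
  by move=> q; rewrite -val_eqE /= => /negPf ->; rewrite mul0r.
exists z; split=> [w u onu|[l i]|jlo jhi].
- rewrite /level opprD addrACA.
  have -> : (u *m rcol R (C k) (lo M k)) 0 0 - (u *m rcol R (C k) j) 0 0 =
    \sum_l x l 0 * (w l (lo M l) - w l (hi M l)).
    transitivity ((u *m (edge_mx R C M *m x)) 0 0).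
      by rewrite mulKVmx ?nondeg_unit // mulmxBr sub_entry.
    rewrite edge_mx_mulr mulmx_sumr summxE; apply: eq_bigr => l _.
    by rewrite -scalemxAr mxE (edge_drop _ onu).
  rewrite -(pair_big xpredT xpredT (fun l i => z (l, i) * w l i)) /=.
  under [RHS]eq_bigr => l _.
    under eq_bigr => i _ do rewrite /z /= mulrDl -!mulrA !mulrBl.
    rewrite big_split /= -!big_distrr /= !sumrB.
    rewrite (pick l) ?wf_lo_lt // (pick l) ?wf_hi_lt //.
    over.
  rewrite big_split /=; congr (_ + _).
  rewrite (bigD1 k) //= eqxx mul1r (pick k) ?wf_lo_lt // (pick k) // big1 ?addr0 //.
  by move=> l /negPf ->; rewrite mul0r.
- rewrite /z /=; apply: contraR; rewrite -leqNgt => il.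
  have ne q : (q < ncols (C l))%N -> (i == q :> nat) = false by lia.
  rewrite (ne (lo M l)) ?(ne (hi M l)) ?wf_lo_lt ?wf_hi_lt // subrr mulr0 add0r.
  have [lk|_] := eqVneq l k; last by rewrite mul0r.
  by rewrite lk in ne; rewrite (ne (lo M k)) ?(ne j) ?wf_lo_lt // subrr mulr0.
- exists (k, Ordinal (colsB _ _ jk)); rewrite /z /=.
  rewrite eqxx (negPf jlo) (negPf jhi) eqxx !subr0 mulr0 add0r mul1r sub0r.
  by rewrite oppr_eq0 oner_eq0.
Qed.

Lemma weak_cell_scale C (w : 'I_n -> nat -> R) c M : 0 < c ->
  weak_cell C (fun k j => c * w k j) M -> weak_cell C w M.
Proof.
move=> c0 [u hu].
have levE k j : level C w (c^-1 *: u) k j = c^-1 * level C (fun k j => c * w k j) u k j.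
  by rewrite /level mulrDr mulKf ?gt_eqF // -scalemxAl mxE.
exists (c^-1 *: u) => k; rewrite !levE; have [-> h] := hu k; split=> // j jk.
by rewrite levE ler_pM2l ?invr_gt0 // h.
Qed.

(** The lexicographic order on pairs (matrix, column) is the order in which
    columns are numbered. *)
Definition lex_monotone C p : Prop :=
  forall k j k' j', (j < ncols (C k))%N -> (j' < ncols (C k'))%N ->
  (p k j < p k' j')%N = (k < k')%N || (k == k') && (j < j')%N.

(** Each slack is a nonzero combination of the powers of e, so by
    [lex_sign_invariant] it is positive for small e as soon as it is nonnegative,
    whatever the positive weights and the monotone exponents. *)
Lemma lex_weak_strict C M p p' (kap kap' : 'I_n -> nat -> R) :
    wf_pairs C M -> nondeg R C M ->
    lex_monotone C p -> lex_monotone C p' ->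
    (forall k j, 0 < kap k j) -> (forall k j, 0 < kap' k j) ->
    (\forall e \near 0^'+, weak_cell C (fun k j => kap k j * e ^+ p k j) M) ->
  \forall e \near 0^'+, strict_cell C (fun k j => kap' k j * e ^+ p' k j) M.
Proof.
move=> wf nd mp mp' kap0 kap'0 weak.
suff near_all : \forall e \near 0^'+, forall k (j : 'I_(ncols (C k))),
    val j != lo M k -> val j != hi M k ->
    forall u, on_edges C (fun k j => kap' k j * e ^+ p' k j) M u ->
    level C (fun k j => kap' k j * e ^+ p' k j) u k j <
    level C (fun k j => kap' k j * e ^+ p' k j) u k (lo M k).
  apply: filterS near_all => e he.
  have [u hu] := on_edges_exists (fun k j => kap' k j * e ^+ p' k j) nd.
  exists u => k; split=> [|j jk jlo jhi]; first exact: hu.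
  exact: (he k (Ordinal jk)).
apply: filter_forall => k; apply: filter_forall => j.
have [z [zE zin zn0]] := slack_form wf nd (ltn_ord j).
have [jlo|jlo] := boolP (val j == lo M k); first by apply: filterE.
have [jhi|jhi] := boolP (val j == hi M k); first by apply: filterE.
have [t0 zt0] := zn0 jlo jhi.
have pos (t : 'I_n * 'I_(max_cols C)) : 0 < kap t.1 t.2 by [].
have pos' (t : 'I_n * 'I_(max_cols C)) : 0 < kap' t.1 t.2 by [].
have pinj s t : z s != 0 -> z t != 0 -> s != t -> p s.1 s.2 != p t.1 t.2.
  move: s t => [k1 j1] [k2 j2] z1 z2 ne /=.
  have := mp _ _ _ _ (zin _ z1) (zin _ z2); have := mp _ _ _ _ (zin _ z2) (zin _ z1).
  move=> /= E1 E2; apply/eqP => e; move: E1 E2; rewrite e ltnn => E1 E2.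
  case/eqP: ne; have k12 : k1 = k2 by apply: val_inj; rewrite /=; lia.
  by congr (_, _) => //; apply: val_inj; move: E1 E2; rewrite k12 eqxx /=; lia.
have pmono s t : z s != 0 -> z t != 0 ->
    (p s.1 s.2 < p t.1 t.2)%N = (p' s.1 s.2 < p' t.1 t.2)%N.
  by move=> zs zt; rewrite mp ?mp' ?zin.
have near_ge0 : \forall e \near 0^'+,
    0 <= \sum_t z t * (kap t.1 t.2 * e ^+ p t.1 t.2).
  apply: filterS weak => e [u hu].
  rewrite -(zE (fun k j => kap k j * e ^+ p k j) u); last by move=> l; case: (hu l).
  by rewrite subr_ge0; case: (hu k) => _; apply.
have := lex_sign_invariant zt0 pos pos' pinj pmono near_ge0.
apply: filterS => e he _ _ u onu.
by rewrite -subr_gt0 zE.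
Qed.

Lemma strict_weak C w M : strict_cell C w M -> weak_cell C w M.
Proof.
case=> u hu; exists u => k; have [e h] := hu k; split=> // j jk.
have [->//|jlo] := eqVneq j (lo M k).
have [->|jhi] := eqVneq j (hi M k); first by rewrite e.
exact/ltW/h.
Qed.

Definition pos C k j := (\sum_(l < n | (l < k)%N) ncols (C l) + j)%N.

Lemma pos_lex C : lex_monotone C (pos C).
Proof.
have step (k k' : 'I_n) j j' : (k < k')%N -> (j < ncols (C k))%N -> (pos C k j < pos C k' j')%N.
  move=> kk jk; rewrite /pos.
  suff : (\sum_(l < n | (l < k)%N) ncols (C l) + ncols (C k) <=
          \sum_(l < n | (l < k')%N) ncols (C l))%N by lia.
  rewrite [leqRHS](bigD1 k) //= addnC leq_add2l.
  rewrite big_mkcond [leqRHS]big_mkcond /=; apply: leq_sum => l _.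
  case: ltnP => // lk; rewrite (ltn_trans lk kk) /=.
  by have -> : l != k by rewrite -val_eqE /=; lia.
move=> k j k' j' jk jk'; case: (ltngtP k k') => [kk|kk|/val_inj kk] /=.
- by rewrite step.
- have -> : (k == k') = false by rewrite -val_eqE /=; lia.
  by apply/negP => h; have := step _ _ j' j kk jk'; lia.
- by rewrite kk eqxx /pos ltn_add2l.
Qed.

Lemma column_pos_val C k (j : 'I_(ncols (C k))) : column_pos C k j = pos C k j :> nat.
Proof. exact: tagnat.RankEsum. Qed.

Lemma lift_value_lex C (e : R) k j : (j < ncols (C k))%N ->
  lift_value (lex_lift C e) k j = e ^+ pos C k j.
Proof.
move=> jk; rewrite -[j]/(val (Ordinal jk)) lift_value_ord.
by rewrite /lex_lift mxE column_pos_val.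
Qed.

Lemma weak_cell_ext C w w' M : wf_pairs C M ->
  (forall k j, (j < ncols (C k))%N -> w k j = w' k j) ->
  weak_cell C w M -> weak_cell C w' M.
Proof.
move=> wf ww [u hu]; exists u => k; have [e h] := hu k.
move: e h; rewrite /level !ww ?wf_lo_lt ?wf_hi_lt // => e h; split=> // j jk.
by rewrite -ww // h.
Qed.

Lemma strict_cell_ext C w w' M : wf_pairs C M ->
  (forall k j, (j < ncols (C k))%N -> w k j = w' k j) ->
  strict_cell C w M -> strict_cell C w' M.
Proof.
move=> wf ww [u hu]; exists u => k; have [e h] := hu k.
move: e h; rewrite /level !ww ?wf_lo_lt ?wf_hi_lt // => e h; split=> // j jk jlo jhi.
by rewrite -ww // h.
Qed.

(** Mixed cells for the lexicographic lift can be tested with any positive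
    weights and any exponents in the same order: this compares tuples whose
    columns are rescaled or padded with further columns. *)
Lemma lex_mixed_cellsP C M p (kap : 'I_n -> nat -> R) (k0 : 'I_n) :
    lex_monotone C p -> (forall k j, 0 < kap k j) ->
  lex_mixed_cells R C M <->
  [/\ wf_pairs C M, nondeg R C M &
     \forall e \near 0^'+, weak_cell C (fun k j => kap k j * e ^+ p k j) M].
Proof.
move=> mp kap0; have pos1 (k : 'I_n) (j : nat) : 0 < (1 : R) by [].
split=> [|[wf nd weak]].
  move=> cells0.
  have {cells0} cells : \forall e \near (0 : R)^'+, mixed_cell (lex_lift C e) M.
    exact: cells0.
  have [e0 /(mixed_cell_weak k0) [wf nd _]] := near0_ex cells.
  split=> //.
  have : \forall e \near 0^'+, weak_cell C (fun k j => (1 : R) * e ^+ pos C k j) M.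
    apply: near0_mono cells => e /(mixed_cell_weak k0) [_ _].
    by apply: weak_cell_ext => // k j jk; rewrite mul1r lift_value_lex.
  move=> /(lex_weak_strict wf nd (@pos_lex C) mp pos1 kap0).
  by apply: near0_mono => e; apply: strict_weak.
have := lex_weak_strict wf nd mp (@pos_lex C) kap0 pos1 weak.
apply: near0_mono => e se; apply: strict_mixed_cell => //.
by apply: strict_cell_ext se => // k j jk; rewrite mul1r lift_value_lex.
Qed.

End LexCells.

(** * From the target lift to the next stage *)

Section Columns.
Variables (R : realType) (n : nat).

Lemma colv_row_mx p q (X : 'M[int]_(n, p)) (Y : 'M[int]_(n, q)) j :
  colv (IntMx (row_mx X Y)) j =
  if (j < p)%N then colv (IntMx X) j else colv (IntMx Y) (j - p).
Proof.
case: ltnP => jp.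
  have jpq : (j < p + q)%N by lia.
  rewrite -[j]/(val (Ordinal jpq)) /colv.
  rewrite !(insubT (fun i => i < _)%N) /= => *.
  apply/matrixP => x y; rewrite !mxE; case: splitP => l /= e; last by lia.
  by congr (X x _); apply: val_inj; rewrite /= -e.
rewrite /colv /=.
case: (ltnP j (p + q)) => jpq; last first.
  have h1 : (j < p + q)%N = false by lia.
  have h2 : (j - p < q)%N = false by lia.
  by rewrite !insubF.
have jq : (j - p < q)%N by lia.
rewrite (insubT (fun i => i < p + q)%N jpq) (insubT (fun i => i < q)%N jq).
apply/matrixP => x y; rewrite !mxE; case: splitP => l /= e; first by have := ltn_ord l; lia.
by congr (Y x _); apply: val_inj; rewrite /=; lia.
Qed.

Lemma colv_scaled c j :
  colv (IntMx (scaled_simplex_mx n c)) j = c *: colv (IntMx (simplex_mx n)) j.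
Proof.
rewrite /colv /=; case: insubP => [l _ _|_]; last by rewrite scaler0.
apply/matrixP => x y; rewrite !mxE; case: splitP => q _; rewrite !mxE ?mulr0 //.
by rewrite mulr_natr.
Qed.

Lemma rcol_simplex0 : rcol R (IntMx (simplex_mx n)) 0 = 0.
Proof.
rewrite /rcol /colv (insubT (fun i => i < 1 + n)%N (isT : (0 < 1 + n)%N)).
by apply/matrixP => x y; rewrite !mxE; case: splitP => q // _; rewrite mxE.
Qed.

Lemma rcol_simplexS (x : 'I_n) :
  rcol R (IntMx (simplex_mx n)) x.+1 = delta_mx x 0.
Proof.
have lt : (x.+1 < 1 + n)%N by rewrite add1n ltnS.
rewrite /rcol /colv (insubT (fun i => i < 1 + n)%N lt).
apply/matrixP => y z; rewrite ord1 !mxE; case: splitP => q /= e.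
  by case: q e => -[].
have -> : q = x by apply: val_inj; rewrite /=; lia.
by rewrite !mxE andbT; case: (y == x).
Qed.

Lemma rcol_eq (C C' : intmx n) j j' : colv C j = colv C' j' ->
  rcol R C j = rcol R C' j'.
Proof. by rewrite /rcol => ->. Qed.

End Columns.

Section Stages.
Variables (R : realType) (n : nat) (m : 'I_n -> nat) (A : forall i, 'M[int]_(n, m i)).
Implicit Types (i k l : 'I_n) (M : pair_tuple n) (u : 'rV[R]_n).

Lemma stage_lt (s : nat) k : (k < s)%N -> stage_tuple A s k = IntMx (A k).
Proof. by rewrite /stage_tuple => ->. Qed.

Lemma stage_ge (s : nat) k : (s <= k)%N -> stage_tuple A s k = IntMx (simplex_mx n).
Proof. by rewrite /stage_tuple ltnNge => ->. Qed.

Lemma aug_eq i : aug_tuple A i i =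
  IntMx (row_mx (scaled_simplex_mx n (mxdeg (A i))) (A i)).
Proof. by rewrite /aug_tuple ltnn eqxx. Qed.

Lemma aug_neq i k : k != i -> aug_tuple A i k = stage_tuple A i k.
Proof. by move=> /negPf ki; rewrite /aug_tuple /stage_tuple ki. Qed.

Lemma stage_succ_neq i k : k != i -> stage_tuple A i.+1 k = stage_tuple A i k.
Proof.
by rewrite -val_eqE /stage_tuple ltnS leq_eqVlt /= => /negPf ->.
Qed.

(** The column of the augmented tuple that carries column j of the next stage:
    in matrix i it comes after the n + 1 columns of the scaled simplex. *)
Definition past_simplex i k (j : nat) := if k == i then (j + n.+1)%N else j.

Lemma ncols_past i k j :
  (past_simplex i k j < ncols (aug_tuple A i k))%N =
  (j < ncols (stage_tuple A i.+1 k))%N.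
Proof.
rewrite /past_simplex; have [->|ki] := eqVneq k i.
  by rewrite aug_eq stage_lt //= addnC ltn_add2l.
by rewrite aug_neq // stage_succ_neq.
Qed.

Lemma rcol_past i k j :
  rcol R (aug_tuple A i k) (past_simplex i k j) = rcol R (stage_tuple A i.+1 k) j.
Proof.
rewrite /past_simplex; have [->|ki] := eqVneq k i.
  apply: rcol_eq; rewrite aug_eq stage_lt // colv_row_mx.
  by rewrite ifN ?addnK // -leqNgt add1n leq_addl.
by rewrite aug_neq // stage_succ_neq.
Qed.

Lemma past_mono i k j j' : (past_simplex i k j < past_simplex i k j')%N = (j < j')%N.
Proof. by rewrite /past_simplex; case: eqP; rewrite // ltn_add2r. Qed.

Lemma past_lex i :
  lex_monotone (stage_tuple A i.+1) (fun k j => pos (aug_tuple A i) k (past_simplex i k j)).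
Proof.
move=> k j k' j' jk jk'; rewrite pos_lex ?ncols_past //.
by case: eqP => // ->; rewrite past_mono.
Qed.

Lemma level_past i (w : 'I_n -> nat -> R) u k j :
  level (aug_tuple A i) w u k (past_simplex i k j) =
  level (stage_tuple A i.+1) (fun k j => w k (past_simplex i k j)) u k j.
Proof. by rewrite /level rcol_past. Qed.

Section Shift.
Variables (i : 'I_n) (M : pair_tuple n).
Hypothesis avoid : avoids_simplex i M.

Lemma lo_past k : past_simplex i k (lo (shift_pair i M) k) = lo M k.
Proof.
rewrite /past_simplex /lo /shift_pair ffunE; case: eqP => // ->.
by case: avoid => /=; lia.
Qed.

Lemma hi_past k : past_simplex i k (hi (shift_pair i M) k) = hi M k.
Proof.
rewrite /past_simplex /hi /shift_pair ffunE; case: eqP => // ->.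
by case: avoid => /=; lia.
Qed.

Lemma wf_past :
  wf_pairs (aug_tuple A i) M <-> wf_pairs (stage_tuple A i.+1) (shift_pair i M).
Proof.
suff eqv k : [&& (0 < (M k).1)%N, ((M k).1 < (M k).2)%N
            & ((M k).2 <= ncols (aug_tuple A i k))%N] =
  [&& (0 < (shift_pair i M k).1)%N, ((shift_pair i M k).1 < (shift_pair i M k).2)%N
            & ((shift_pair i M k).2 <= ncols (stage_tuple A i.+1 k))%N].
  by split=> h k; [rewrite -eqv | rewrite eqv].
rewrite /shift_pair ffunE.
have := ncols_past i k ((M k).2 - n.+2); have := ncols_past i k (M k).2.-1.
rewrite /past_simplex; case: eqP => [->|_ E _]; last first.
  by case: (M k) E => [x [|q]] /=; [lia | move=> ->].
by case: avoid => /=; lia.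
Qed.

Lemma edge_past k :
  edge R (aug_tuple A i) M k = edge R (stage_tuple A i.+1) (shift_pair i M) k.
Proof. by rewrite /edge -!rcol_past lo_past hi_past. Qed.

Lemma nondeg_past :
  nondeg R (aug_tuple A i) M <-> nondeg R (stage_tuple A i.+1) (shift_pair i M).
Proof.
by split=> nd u hu; apply: nd => k; [rewrite edge_past | rewrite -edge_past].
Qed.

Lemma lift_value_target (e del : R) k j : (j < ncols (aug_tuple A i k))%N ->
  lift_value (target_lift A R i + del *: lex_lift (aug_tuple A i) e) k j =
  (if (k == i) && (j < n.+1)%N then -1 else 0) + del * e ^+ pos (aug_tuple A i) k j.
Proof.
move=> jk; rewrite -[j]/(val (Ordinal jk)) lift_value_ord mxE; congr (_ + _).
  have sig2E : tagnat.sig2 (column_pos (aug_tuple A i) k (Ordinal jk)) = j :> nat.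
    by rewrite tagnat.Rank2K.
  by rewrite /target_lift mxE sig2E tagnat.Rank1K.
by rewrite mxE mxE column_pos_val.
Qed.

(** On the columns other than those of the scaled simplex the lift is del times
    a lexicographic one, so u and the levels of the pairs of M are of order del. The simplex columns are at -1
    plus terms of order del, hence below the top once del is small. *)
Lemma target_cells_shift :
  lex_mixed_cells_at (target_lift A R i) M <->
  lex_mixed_cells R (stage_tuple A i.+1) (shift_pair i M).
Proof.
set P := aug_tuple A i; set Q := stage_tuple A i.+1; set M' := shift_pair i M.
have one_gt0 (k : 'I_n) (j : nat) : 0 < (1 : R) by [].
have past_ge k j : (k == i) && (past_simplex i k j < n.+1)%N = false.
  by rewrite /past_simplex; case: eqP => //= _; lia.
rewrite (lex_mixed_cellsP M' i (@past_lex i) one_gt0); split.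
  move=> cells0.
  have {cells0} cells : \forall e \near (0 : R)^'+, \forall del \near (0 : R)^'+,
     mixed_cell (target_lift A R i + del *: lex_lift P e) M by exact: cells0.
  have {}cells : \forall e \near (0 : R)^'+, exists2 del, 0 < del &
     mixed_cell (target_lift A R i + del *: lex_lift P e) M.
    apply: near0_mono cells => e /(near0_and (near0_gt0 R)) /near0_ex[del [d0 hd]].
    by exists del.
  have [e0 [del0 _ /(mixed_cell_weak i) [wf nd _]]] := near0_ex cells.
  split; [exact/wf_past | exact/nondeg_past |].
  apply: near0_mono cells => e [del del0' /(mixed_cell_weak i) [_ _ [u hu]]].
  apply: (weak_cell_scale del0'); exists u => k.
  have levE j : (j < ncols (Q k))%N ->
     level Q (fun k j => del * (1 * e ^+ pos P k (past_simplex i k j))) u k j =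
     level P (lift_value (target_lift A R i + del *: lex_lift P e))
       u k (past_simplex i k j).
    move=> jk; rewrite level_past /level; congr (_ + _).
    by rewrite lift_value_target ?ncols_past // past_ge add0r mul1r.
  have wf' : wf_pairs Q M' by apply/wf_past.
  have [e1 h1] := hu k; split.
    by rewrite !levE ?wf_lo_lt ?wf_hi_lt // lo_past hi_past.
  by move=> j jk; rewrite !levE ?wf_lo_lt // lo_past h1 // ncols_past.
case=> wf' nd' weak.
have wf : wf_pairs P M by apply/wf_past.
have nd : nondeg R P M by apply/nondeg_past.
have strict := lex_weak_strict wf' nd' (@past_lex i) (@past_lex i) one_gt0 one_gt0 weak.
suff near2 : \forall e \near (0 : R)^'+, \forall del \near (0 : R)^'+,
     mixed_cell (target_lift A R i + del *: lex_lift P e) M by exact: near2.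
apply: near0_mono strict => e [u hu].
pose w := fun k j => e ^+ pos P k j.
pose gap (j : 'I_n.+1) : R := level P w u i j - level P w u i (lo M i).
have gap_small (j : 'I_n.+1) : \forall del \near (0 : R)^'+, del * gap j < 1.
  have q0 : 0 < (`|gap j| + 1)^-1 by rewrite invr_gt0 ltr_wpDl.
  apply: near0_mono (near0_and (near0_gt0 R) (near0_lt q0)) => del [d0].
  rewrite -[_^-1]mul1r ltr_pdivlMr ?ltr_wpDl // => d1.
  apply: le_lt_trans d1; apply: ler_wpM2l; first exact: ltW.
  by apply: le_trans (ler_norm _) _; rewrite lerDl.
have /near0_and /(_ (near0_gt0 R)) :
    \forall del \near (0 : R)^'+, forall j : 'I_n.+1, del * gap j < 1.
  exact: filter_forall.
apply: near0_mono => del [gapd d0]; apply: (strict_mixed_cell i wf nd).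
have levE k j : (j < ncols (P k))%N ->
    level P (lift_value (target_lift A R i + del *: lex_lift P e)) (del *: u) k j =
    (if (k == i) && (j < n.+1)%N then -1 else 0) + del * level P w u k j.
  move=> jk; rewrite /level lift_value_target // -scalemxAl mxE mulrDr.
  by rewrite addrCA addrC.
have levQ k j : level P w u k (past_simplex i k j) =
    level Q (fun k j => 1 * e ^+ pos P k (past_simplex i k j)) u k j.
  by rewrite level_past /level mul1r.
have lo_ge k : (k == i) && (lo M k < n.+1)%N = false by rewrite -lo_past past_ge.
have hi_ge k : (k == i) && (hi M k < n.+1)%N = false by rewrite -hi_past past_ge.
exists (del *: u) => k; have [e1 h1] := hu k.
rewrite !levE ?wf_lo_lt ?wf_hi_lt // lo_ge hi_ge !add0r; split.
  by rewrite -lo_past -hi_past !levQ e1.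
move=> j jk jlo jhi; rewrite levE //.
case: ifP => [/andP[/eqP ki jn]|jn].
  move: (gapd (Ordinal jn)); rewrite /gap /= -ki mulrBr ltrBlDr => lt1.
  by rewrite addrC ltrBlDr [ltRHS]addrC.
rewrite add0r ltr_pM2l //.
have [j' jE] : exists j', j = past_simplex i k j'.
  move: jn; rewrite /past_simplex; case: eqP => _ /= jn; last by exists j.
  by exists (j - n.+1)%N; lia.
rewrite -lo_past jE !levQ; apply: h1.
- by rewrite -ncols_past -jE.
- by apply: contraNneq jlo => e2; rewrite jE e2 lo_past.
- by apply: contraNneq jhi => e2; rewrite jE e2 hi_past.
Qed.

End Shift.

Lemma shift_target_cells i :
  [set shift_pair i M | M in
    [set M | lex_mixed_cells_at (target_lift A R i) M /\ avoids_simplex i M]] =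
  lex_mixed_cells R (stage_tuple A i.+1).
Proof.
apply/seteqP; split=> [_ [M [cM av] <-]|M' cM'].
  exact/(target_cells_shift av).
have one_gt0 (k : 'I_n) (j : nat) : 0 < (1 : R) by [].
have [wf _ _] := (lex_mixed_cellsP M' i (@pos_lex _ _) one_gt0).1 cM'.
pose M : pair_tuple n :=
  [ffun k => if k == i then ((M' k).1 + n.+1, (M' k).2 + n.+1)%N else M' k].
have av : avoids_simplex i M.
  by rewrite /avoids_simplex ffunE eqxx /=; move/and3P: (wf i) => []; lia.
have sM : shift_pair i M = M'.
  apply/ffunP => k; rewrite !ffunE; case: eqP => // _ /=.
  by rewrite !addnK; case: (M' k).
by exists M => //; split=> //; apply/(target_cells_shift av); rewrite sM.
Qed.

End Stages.

(** * Adding the columns of a matrix inside a scaled simplex *)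

Section Rescaling.
Variables (R : realType) (n : nat) (m : 'I_n -> nat) (A : forall i, 'M[int]_(n, m i)).
Hypothesis A_ge0 : forall (i k : 'I_n) (j : 'I_(m i)), 0 <= A i k j.
Variable i : 'I_n.
Hypothesis deg_gt0 : 0 < mxdeg (A i).
Implicit Types (k l : 'I_n) (M : pair_tuple n) (u : 'rV[R]_n).

Local Notation P := (aug_tuple A i).
Local Notation Q := (stage_tuple A i).
Local Notation deg := ((mxdeg (A i))%:~R : R).

Definition dilation k : R := if k == i then deg else 1.

Lemma dilation_gt0 k : 0 < dilation k.
Proof. by rewrite /dilation; case: eqP; rewrite ?ltr01 ?ltr0z. Qed.

Lemma ncols_stage_aug k j : (j < ncols (Q k))%N -> (j < ncols (P k))%N.
Proof.
have [->|ki] := eqVneq k i.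
  by rewrite aug_eq stage_ge //= => ?; rewrite ltn_addr.
by rewrite aug_neq.
Qed.

Lemma rcol_dilation k j : (j < ncols (Q k))%N ->
  rcol R (P k) j = dilation k *: rcol R (Q k) j.
Proof.
rewrite /dilation; have [->|ki] := eqVneq k i.
  rewrite aug_eq stage_ge //= => jn.
  rewrite /rcol colv_row_mx jn colv_scaled.
  by apply/matrixP => x y; rewrite !mxE intrM.
by rewrite aug_neq // scale1r.
Qed.

(** A dilation of the columns by a factor amounts to dividing the lift by it. *)
Lemma level_dilation w u k j : (j < ncols (Q k))%N ->
  level P w u k j = dilation k * level Q (fun k j => (dilation k)^-1 * w k j) u k j.
Proof.
move=> jk; rewrite /level rcol_dilation // -scalemxAr mxE.
by rewrite [RHS]mulrDr mulVKf // gt_eqF // dilation_gt0.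
Qed.

Lemma col_sum_le_deg (l : 'I_(m i)) : \sum_x A i x l <= mxdeg (A i).
Proof. by have := @le_bigmax _ _ _ (0 : int) (fun q : 'I_(m i) => \sum_x A i x q) l. Qed.

(** A column of A i is a convex combination of the columns of the scaled simplex,
    as its entries are nonnegative of sum at most the degree; all of those have
    larger lifts, since they come first. *)
Lemma added_column_below e u (top : R) j : 0 < e < 1 ->
    (forall j', (j' < n.+1)%N -> level P (fun k j => e ^+ pos P k j) u i j' <= top) ->
    (n.+1 <= j)%N -> (j < ncols (P i))%N ->
  level P (fun k j => e ^+ pos P k j) u i j < top.
Proof.
case/andP=> e0 e1 hle nj jP; set w := fun k j => _ in hle *.
have simplex_cols j' : (j' < n.+1)%N ->
    rcol R (P i) j' = deg *: rcol R (IntMx (simplex_mx n)) j'.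
  move=> jn; rewrite rcol_dilation; last by rewrite stage_ge.
  by rewrite /dilation eqxx stage_ge.
have w_anti j1 j2 : (j1 <= j2)%N -> w i j2 <= w i j1.
  by move=> jj; rewrite /w ler_wiXn2l ?leq_add2l // ltW.
have wj : w i j < w i n.
  by rewrite /w ltr_iXn2l // ltn_add2l.
set g := top - w i n.
have g_ge0 : 0 <= g.
  have := hle 0%N isT; have := w_anti _ _ (leq0n n).
  rewrite /level simplex_cols // rcol_simplex0 scaler0 mulmx0 mxE /g; lra.
have ux_le x : deg * u 0 x <= g.
  have xn : (x.+1 < n.+1)%N by rewrite ltnS.
  have := hle x.+1 xn; have := w_anti _ _ (ltn_ord x).
  rewrite /level simplex_cols // rcol_simplexS -scalemxAr -colE !mxE /g; lra.
have jm : (j - n.+1 < m i)%N.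
  by move: jP; rewrite aug_eq /= => ?; lia.
pose l := Ordinal jm.
have colE : rcol R (P i) j = map_mx intr (col l (A i)).
  rewrite /rcol aug_eq colv_row_mx ifN -?leqNgt //.
  by rewrite -[(j - (1 + n))%N]/(val l) (colv_ord (C := IntMx (A i)) l).
have dpos : 0 < deg by rewrite ltr0z.
have : (u *m rcol R (P i) j) 0 0 <= g.
  rewrite -(ler_pM2l dpos) colE mxE big_distrr /=.
  apply: (@le_trans _ _ (\sum_x g * (A i x l)%:~R)).
    apply: ler_sum => x _; rewrite !mxE mulrA ler_wpM2r ?ux_le //.
    by rewrite ler0z.
  rewrite -big_distrr /= mulrC ler_wpM2r //.
  by rewrite -(rmorph_sum (intr : int -> R)) /= ler_int col_sum_le_deg.
by rewrite /level /g; lra.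
Qed.

(** By [added_column_below] the columns of A i neither occur in a mixed cell nor
    impose a condition; the dilation of the simplex is absorbed by the weights. *)
Lemma aug_lex_cells M :
  lex_mixed_cells R P M <-> lex_mixed_cells R Q M.
Proof.
have one_gt0 (k : 'I_n) (j : nat) : 0 < (1 : R) by [].
have kap_gt0 (k : 'I_n) (j : nat) : 0 < (dilation k)^-1.
  by rewrite invr_gt0 dilation_gt0.
have pmono : lex_monotone Q (pos P).
  by move=> k j k' j' jk jk'; rewrite pos_lex ?ncols_stage_aug.
rewrite (lex_mixed_cellsP M i (@pos_lex _ P) one_gt0).
rewrite (lex_mixed_cellsP M i pmono kap_gt0).
have edgeE : wf_pairs Q M -> forall k,
    edge R P M k = dilation k *: edge R Q M k.
  by move=> wf k; rewrite /edge !rcol_dilation ?wf_lo_lt ?wf_hi_lt // scalerBr.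
have nondegE : wf_pairs Q M -> nondeg R P M <-> nondeg R Q M.
  move=> wf; split=> nd u hu; apply: nd => k.
    by rewrite edgeE // -scalemxAr hu scaler0.
  apply/eqP; have /eqP := hu k; rewrite edgeE // -scalemxAr scaler_eq0.
  by rewrite gt_eqF ?dilation_gt0.
split=> -[wf nd weak]; last first.
  split; first by move=> k; move/and3P: (wf k) => [h1 h2 h3];
     rewrite h1 h2 /=; have := @ncols_stage_aug k (M k).2.-1; lia.
    exact/nondegE.
  have small : \forall e \near (0 : R)^'+, 0 < e < 1.
    by apply: near0_mono (near0_and (near0_gt0 R) (near0_lt ltr01)) => e [-> ->].
  apply: near0_mono (near0_and small weak) => e [he [u hu]].
  pose w (k : 'I_n) (j : nat) := 1 * e ^+ pos P k j.
  have lowE k j : (j < ncols (Q k))%N -> level P w u k j =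
      dilation k * level Q (fun k j => (dilation k)^-1 * e ^+ pos P k j) u k j.
    move=> jk; rewrite level_dilation // /level; congr (_ * (_ + _)).
    by rewrite /w mul1r.
  have low_le k j : (j < ncols (Q k))%N -> level P w u k j <= level P w u k (lo M k).
    move=> jk; rewrite !lowE ?wf_lo_lt // ler_pM2l ?dilation_gt0 //.
    by case: (hu k) => _; apply.
  exists u => k; have [e1 h1] := hu k.
  rewrite -/w; split; first by rewrite !lowE ?wf_lo_lt ?wf_hi_lt // e1.
  move=> j jP; have [jQ|jQ] := ltnP j (ncols (Q k)); first exact: low_le.
  have ki : k = i.
    apply/eqP; apply: contraTT jP => ki; rewrite -leqNgt; apply: leq_trans jQ.
    by rewrite aug_neq.
  subst k; apply: ltW.
  have := @added_column_below e u (level P w u i (lo M i)) j he.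
  rewrite /w /level mul1r => h; rewrite mul1r; apply: h => //.
    by move=> j' jn; have := low_le i j'; rewrite /w /level !mul1r; apply; rewrite stage_ge.
  by move: jQ; rewrite stage_ge.
have small : \forall e \near (0 : R)^'+, 0 < e < 1.
  by apply: near0_mono (near0_and (near0_gt0 R) (near0_lt ltr01)) => e [-> ->].
have hi_small : (hi M i < n.+1)%N.
  have [e [he [u hu]]] := near0_ex (near0_and small weak).
  have [e1 h1] := hu i; rewrite ltnNge; apply/negP => nhi.
  have := @added_column_below e u
    (level P (fun k j => 1 * e ^+ pos P k j) u i (lo M i)) (hi M i) he.
  have levE j : level P (fun k j => e ^+ pos P k j) u i j =
     level P (fun k j => 1 * e ^+ pos P k j) u i j by rewrite /level mul1r.
  rewrite levE e1 ltxx => h; suff : false by []; apply: h => //.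
    move=> j' jn; rewrite levE; apply: h1; apply: ncols_stage_aug.
    by rewrite stage_ge.
  exact: wf_hi_lt.
have wfQ : wf_pairs Q M.
  move=> k; have := wf k; have [->|ki] := eqVneq k i.
    rewrite stage_ge //= => /and3P[-> -> _] /=.
    by move: hi_small; rewrite /hi; lia.
  by rewrite aug_neq.
split=> //; first exact/nondegE.
apply: near0_mono weak => e [u hu].
have lowE k j : (j < ncols (Q k))%N ->
    level P (fun k j => 1 * e ^+ pos P k j) u k j =
    dilation k * level Q (fun k j => (dilation k)^-1 * e ^+ pos P k j) u k j.
  move=> jk; rewrite level_dilation // /level; congr (_ * (_ + _)).
  by rewrite mul1r.
have inj k := mulfI (lt0r_neq0 (dilation_gt0 k)).
exists u => k; have [e1 h1] := hu k; split.
  by apply: (inj k); rewrite -!lowE ?wf_lo_lt ?wf_hi_lt.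
move=> j jk; rewrite -(ler_pM2l (dilation_gt0 k)) -!lowE ?wf_lo_lt //.
exact/h1/ncols_stage_aug.
Qed.

End Rescaling.

(** * The start: copies of the standard simplex *)

Section Simplices.
Variables (R : realType) (n : nat).
Implicit Types (C : mxtuple n) (k : 'I_n) (M : pair_tuple n) (u : 'rV[R]_n).

Local Notation simplex := (IntMx (simplex_mx n)).

Definition vertex_height u j : R := (u *m rcol R simplex j) 0 0.

Lemma vertex_height0 u : vertex_height u 0 = 0.
Proof. by rewrite /vertex_height rcol_simplex0 mulmx0 mxE. Qed.

Lemma vertex_heightS u (x : 'I_n) : vertex_height u x.+1 = u 0 x.
Proof. by rewrite /vertex_height rcol_simplexS -colE mxE. Qed.

Lemma vertex_heights_exist (U : nat -> R) : U 0%N = 0 ->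
  exists u, forall j, (j < n.+1)%N -> vertex_height u j = U j.
Proof.
move=> U0; exists (\row_x U x.+1) => -[_|j jn]; first by rewrite vertex_height0.
by rewrite -[j]/(val (Ordinal (jn : (j < n)%N))) vertex_heightS mxE.
Qed.

Section AllSimplices.
Variable C : mxtuple n.
Hypothesis C_simplex : forall k, C k = simplex.

Lemma level_vertex w u k j : level C w u k j = vertex_height u j + w k j.
Proof. by rewrite /level C_simplex. Qed.

Lemma ncols_vertex k : ncols (C k) = n.+1.
Proof. by rewrite C_simplex. Qed.

Lemma edge_vertex M u k : (u *m edge R C M k) 0 0 =
  vertex_height u (hi M k) - vertex_height u (lo M k).
Proof. by rewrite /edge mulmxBr sub_entry C_simplex. Qed.

(** The n tropical hyperplanes defined by a generic lift meet in one point: if K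
    is the set of vertices where u' - u is maximal, every edge of M has both or
    none of its ends in K, so the functional that is constant on K and on its
    complement kills all edges and K is everything. *)
Lemma potential_unique (w : 'I_n -> nat -> R) M M' u u' :
    wf_pairs C M -> wf_pairs C M' -> nondeg R C M ->
    (forall k, level C w u k (hi M k) = level C w u k (lo M k) /\
      forall j, (j < ncols (C k))%N -> j != lo M k -> j != hi M k ->
      level C w u k j < level C w u k (lo M k)) ->
    (forall k, level C w u' k (hi M' k) = level C w u' k (lo M' k) /\
      forall j, (j < ncols (C k))%N ->
      level C w u' k j <= level C w u' k (lo M' k)) ->
  forall j, (j < n.+1)%N -> vertex_height u' j = vertex_height u j.
Proof.
move=> wf wf' nd hu hu'.
pose D j := vertex_height u' j - vertex_height u j.
have [jm Dmax] : exists jm : 'I_n.+1, forall j : 'I_n.+1, D j <= D jm.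
  case: (@arg_maxP _ _ _ (ord0 : 'I_n.+1) xpredT (fun j => D j) isT) => jm _ h.
  by exists jm => j; apply: h.
have D_le j : (j < n.+1)%N -> D j <= D jm by move=> jn; apply: (Dmax (Ordinal jn)).
have levD k j : level C w u' k j = level C w u k j + D j.
  by rewrite !level_vertex /D; ring.
have level_le k j : (j < ncols (C k))%N -> level C w u k j <= level C w u k (lo M k).
  move=> jk; have [e1 h1] := hu k.
  have [->//|jlo] := eqVneq j (lo M k).
  have [->|jhi] := eqVneq j (hi M k); first by rewrite e1.
  exact/ltW/h1.
(* An edge of M with just one end in the set where D is maximal would leave
   a single maximizing column in its row for the potential of M'. *)
have both k a b : level C w u k a = level C w u k (lo M k) ->
    (forall j, (j < ncols (C k))%N -> j != a -> j != b ->
      level C w u k j < level C w u k (lo M k)) ->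
    (a < ncols (C k))%N -> (b < ncols (C k))%N ->
    D a = D jm -> D b = D jm.
  move=> ea hlt aC bC Da; apply/eqP/negPn/negP => Db.
  have Db_lt : D b < D jm.
    by rewrite lt_neqAle Db D_le // -(ncols_vertex k).
  have below j : (j < ncols (C k))%N -> j != a ->
      level C w u' k j < level C w u' k a.
    move=> jk ja; rewrite !levD Da ea.
    have [->|jb] := eqVneq j b; first by rewrite ler_ltD // level_le.
    by rewrite ltr_leD ?hlt // D_le // -(ncols_vertex k).
  have [e2 h2] := hu' k; have ge := h2 _ aC.
  have lo_a : lo M' k = a.
    apply/eqP/negPn/negP => ne; have := below _ (wf_lo_lt k wf') ne.
    by rewrite ltNge ge.
  have hi_a : hi M' k = a.
    apply/eqP/negPn/negP => ne; have := below _ (wf_hi_lt k wf') ne.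
    by rewrite e2 ltNge ge.
  by have := wf_lo_lt_hi k wf'; rewrite lo_a hi_a ltnn.
pose chi j : R := (D j == D jm)%:R.
have [v vE] := @vertex_heights_exist (fun j => chi j - chi 0%N) (subrr _).
have v0 : v = 0.
  apply: nd => k; apply/matrixP => x y; rewrite !ord1 edge_vertex [RHS]mxE.
  rewrite !vE -?(ncols_vertex k) ?wf_lo_lt ?wf_hi_lt //.
  have [e1 h1] := hu k.
  have lohi := both k _ _ (erefl _) h1 (wf_lo_lt k wf) (wf_hi_lt k wf).
  have hilo := both k _ _ e1 (fun j jk jh jl => h1 j jk jl jh) (wf_hi_lt k wf) (wf_lo_lt k wf).
  suff -> : chi (hi M k) = chi (lo M k) by rewrite subrr.
  rewrite /chi; congr (_%:R); congr nat_of_bool.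
  by apply/eqP/eqP.
have chi0 j : (j < n.+1)%N -> chi j = chi 0%N.
  move=> jn; apply/eqP; rewrite -subr_eq0 -vE // v0.
  by rewrite /vertex_height mul0mx mxE.
have D0 : D 0%N = 0 by rewrite /D !vertex_height0 subrr.
have all_max j : (j < n.+1)%N -> D j = D jm.
  move=> jn; have : chi j = 1 by rewrite chi0 // -(chi0 _ (ltn_ord jm)) /chi eqxx.
  by rewrite /chi; case: eqP => // _ /eqP; rewrite eq_sym oner_eq0.
move=> j jn; apply/eqP; rewrite -subr_eq0 -/(D j).
by rewrite all_max // -(all_max 0%N) // D0.
Qed.

Lemma strict_cell_unique (w : 'I_n -> nat -> R) M M' :
    wf_pairs C M -> wf_pairs C M' -> nondeg R C M ->
    strict_cell C w M -> strict_cell C w M' -> M = M'.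
Proof.
move=> wf wf' nd [u hu] [u' hu'].
have le' k j : (j < ncols (C k))%N -> level C w u' k j <= level C w u' k (lo M' k).
  move=> jk; have [e1 h1] := hu' k.
  have [->//|jlo] := eqVneq j (lo M' k).
  have [->|jhi] := eqVneq j (hi M' k); first by rewrite e1.
  exact/ltW/h1.
have uu' := potential_unique wf wf' nd hu (fun k => conj (proj1 (hu' k)) (le' k)).
have lev k j : (j < ncols (C k))%N -> level C w u' k j = level C w u k j.
  by move=> jk; rewrite !level_vertex uu' // -(ncols_vertex k).
apply/ffunP => k.
have in_pair j : (j < ncols (C k))%N ->
    level C w u' k j = level C w u' k (lo M' k) -> (j == lo M k) || (j == hi M k).
  move=> jk ej; apply/negPn/negP; rewrite negb_or => /andP[jlo jhi].
  have [_ h1] := hu k; have := h1 j jk jlo jhi.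
  by rewrite -!lev ?wf_lo_lt // ltNge ej le' // wf_lo_lt.
have := in_pair _ (wf_lo_lt k wf') (erefl _).
have := in_pair _ (wf_hi_lt k wf') (proj1 (hu' k)).
have := wf_lo_lt_hi k wf; have := wf_lo_lt_hi k wf'.
have /and3P[a1 a2 _] := wf k; have /and3P[b1 b2 _] := wf' k.
rewrite /lo /hi; move: a1 a2 b1 b2.
case: (M k) => x y; case: (M' k) => x' y' /= *.
by congr (_, _); lia.
Qed.

(** The numbering of columns when each matrix has n + 1 of them. *)
Definition row_major k j := (k * n.+1 + j)%N.

Lemma row_major_lex : lex_monotone C row_major.
Proof.
move=> k j k' j'; rewrite !ncols_vertex /row_major => jn jn'.
case: (ltngtP k k') => [kk|kk|/val_inj kk] /=.
- apply/idP; nia.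
- have -> : (k == k') = false by rewrite -val_eqE /=; lia.
  apply/negbTE; rewrite -leqNgt; nia.
- by rewrite kk eqxx ltn_add2l.
Qed.

Lemma start_wf : wf_pairs C (start_tuple n).
Proof. by move=> k; rewrite ncols_vertex ffunE /= !ltnS leqnn ltn_ord. Qed.

Lemma start_lo k : lo (start_tuple n) k = k.
Proof. by rewrite /lo ffunE. Qed.

Lemma start_hi k : hi (start_tuple n) k = k.+1.
Proof. by rewrite /hi ffunE. Qed.

Lemma start_nondeg : nondeg R C (start_tuple n).
Proof.
move=> u hu.
have step (k : 'I_n) : vertex_height u k.+1 = vertex_height u k.
  have /matrixP /(_ 0 0) := hu k; rewrite edge_vertex start_lo start_hi mxE.
  by move=> /eqP; rewrite subr_eq0 => /eqP.
have all0 j : (j < n.+1)%N -> vertex_height u j = 0.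
  elim: j => [|j IH] jn; first exact: vertex_height0.
  by rewrite (step (Ordinal (jn : (j < n)%N))) /= IH // ltnW.
by apply/matrixP => x k; rewrite ord1 [RHS]mxE -vertex_heightS all0 // ltnS.
Qed.

(** The heights U with U (j + 1) = U j + w j j - w j (j + 1) put columns k and
    k + 1 at the same level in row k. For e < 1/2 the lift of a column is at most
    half of the lift of any earlier column, so the other columns stay below. *)
Lemma start_weak (e : R) : 0 < e -> e < 2^-1 ->
  weak_cell C (fun k j => 1 * e ^+ row_major k j) (start_tuple n).
Proof.
move=> e0 e_half.
have e1 : e <= 1 by lra.
pose w (k j : nat) : R := e ^+ (k * n.+1 + j).
have w_gt0 (a b : nat) : 0 < w a b by rewrite exprn_gt0.
have w_le (a b c d : nat) : (c * n.+1 + d <= a * n.+1 + b)%N -> w a b <= w c d.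
  by move=> h; rewrite ler_wiXn2l // ltW.
have w_half (a b c d : nat) : (c * n.+1 + d < a * n.+1 + b)%N -> w a b <= w c d / 2.
  move=> h; apply: (@le_trans _ _ (w c d * e)).
    by rewrite /w -exprSr ler_wiXn2l // ltW.
  by rewrite ler_pM2l // ltW.
pose U j := \sum_(0 <= l < j) (w l l - w l l.+1).
have US j : U j.+1 = U j + w j j - w j j.+1 by rewrite /U big_nat_recr //= addrA.
have [u uE] := @vertex_heights_exist U (big_geq (leqnn 0)).
exists u => k; rewrite start_lo start_hi !level_vertex.
rewrite !uE ?ltnS ?ltn_ord ?(ltnW (ltn_ord k)) // !mul1r.
rewrite -!/(w _ _); split; first by rewrite US; lra.
move=> j; rewrite ncols_vertex => jn; rewrite level_vertex uE // mul1r -/(w k j).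
have Uinc a b : (a <= b)%N -> U a <= U b.
  move=> /subnKC <-; elim: (b - a)%N => [|c IH]; first by rewrite addn0.
  rewrite addnS US; have : w (a + c)%N (a + c).+1 <= w (a + c)%N (a + c)%N.
    by apply: w_le; lia.
  by lra.
case: (ltngtP j k) => [jk|jk|->//].
  have [q kE] : exists q : nat, k = q.+1 :> nat.
    by exists k.-1; rewrite prednK //; lia.
  rewrite kE in jk *.
  have qn : (q < n)%N by rewrite -ltnS -kE ltnW // ltnS ltn_ord.
  have h1 : w q.+1 j <= w q q / 2 by apply: w_half; nia.
  have h2 : w q q.+1 <= w q q / 2 by apply: w_half; nia.
  have := Uinc j q jk; have := w_gt0 q.+1 q.+1.
  by rewrite US; lra.
have [->|jk'] := eqVneq j k.+1; first by rewrite US; lra.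
(* Beyond column k + 1 the quantity U b + w (b - 1) b is nonincreasing in b. *)
have chain c : U (k.+2 + c)%N + w (k.+1 + c)%N (k.+2 + c)%N <= U k.+1 + w k.+1 k.+1.
  elim: c => [|c IH]; first by rewrite !addn0 US; lra.
  rewrite !addnS US addSn; rewrite !addSn in IH.
  have : w (k + c).+2 (k + c).+2 <= w (k + c).+1 (k + c).+2 by apply: w_le; nia.
  by rewrite !addSn; lra.
have := chain (j - k.+2)%N.
have -> : (k.+2 + (j - k.+2) = j)%N by lia.
have h1 : w k j <= w k k.+1 / 2 by apply: w_half; lia.
have h2 : w k.+1 k.+1 <= w k k.+1 / 2 by apply: w_half; nia.
have := w_gt0 (k.+1 + (j - k.+2))%N j.
by move: (US k); lra.
Qed.

Lemma start_cells (k0 : 'I_n) : lex_mixed_cells R C = [set start_tuple n].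
Proof.
have one_gt0 (k : 'I_n) (j : nat) : 0 < (1 : R) by [].
have half_gt0 : 0 < 2^-1 :> R by rewrite invr_gt0 ltr0n.
have start_near : \forall e \near (0 : R)^'+,
    weak_cell C (fun k j => 1 * e ^+ row_major k j) (start_tuple n).
  apply: near0_mono (near0_and (near0_gt0 R) (near0_lt half_gt0)) => e [e0 e1].
  exact: start_weak.
apply/seteqP; split=> [M|_ ->].
  move=> /(lex_mixed_cellsP M k0 row_major_lex one_gt0) [wf nd weak].
  have s1 := lex_weak_strict wf nd row_major_lex row_major_lex one_gt0 one_gt0 weak.
  have s2 := lex_weak_strict start_wf start_nondeg row_major_lex row_major_lex
    one_gt0 one_gt0 start_near.
  have [e [E1 E2]] := near0_ex (near0_and s1 s2).
  exact: strict_cell_unique wf start_wf nd E1 E2.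
apply/(lex_mixed_cellsP _ k0 row_major_lex one_gt0); split=> //.
  exact: start_wf.
exact: start_nondeg.
Qed.

End AllSimplices.
End Simplices.

(** * Correctness of the procedure *)

Theorem mainTheorem1 (R : realType) (n : nat) (n_ge1 : (1 <= n)%N)
    (m : 'I_n -> nat) (A : forall i : 'I_n, 'M[int]_(n, m i))
    (A_ge0 : forall (i k : 'I_n) (j : 'I_(m i)), 0 <= A i k j)
    (S : nat -> set (pair_tuple n)) (S' S'' : 'I_n -> set (pair_tuple n))
    (S_0 : S 0%N = [set start_tuple n])
    (S'_def : forall i : 'I_n,
       S' i = lex_mixed_cells_at (target_lift A R i))
    (S''_def : forall i : 'I_n,
       S'' i = [set M | S' i M /\ avoids_simplex i M])
    (S_succ : forall i : 'I_n, S i.+1 = [set shift_pair i M | M in S'' i]) :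
  (forall i : 'I_n,
     S i = lex_mixed_cells R (stage_tuple A i) /\
     (0 < mxdeg (A i) ->
        S i = lex_mixed_cells R (aug_tuple A i) /\
        (forall thc, tropical_homotopy_continuation thc ->
           thc (aug_tuple A i) (S i) (target_lift A R i) = S' i))) /\
  S n = lex_mixed_cells R (fun k : 'I_n => IntMx (A k)).
Proof.
have S_stage s : (s <= n)%N -> S s = lex_mixed_cells R (stage_tuple A s).
  case: s => [_|s sn].
    by rewrite S_0 (start_cells R (C := stage_tuple A 0) _ (Ordinal n_ge1)) // => k; rewrite stage_ge.
  by rewrite (S_succ (Ordinal sn)) S''_def S'_def -(shift_target_cells R A (Ordinal sn)).
split=> [i|].
  have Si := S_stage i (ltnW (ltn_ord i)); split=> // deg_gt0.
  have Si_aug : S i = lex_mixed_cells R (aug_tuple A i).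
    rewrite Si; apply/seteqP; split=> M.
      by move=> /(aug_lex_cells R A_ge0 deg_gt0).
    by move=> /(aug_lex_cells R A_ge0 deg_gt0).
  by split=> // thc thc_spec; rewrite S'_def; apply: thc_spec.
rewrite S_stage //; congr lex_mixed_cells.
by apply/funext => k; rewrite stage_lt.
Qed.
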